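(* Let $\mathcal{N}$ be a model of the base theory $F$ ($=\mathrm{RCA}_0^*$). In $\mathcal{N}$, the following are equivalent: (a) Every finite union of finite c.e. sets is finite. (b) $\mathrm{B}\Sigma^0_2$. (c) The Infinite Pigeonhole Principle (i.e. the Infinite $\Sigma^0_1$-Pigeonhole Principle, denoted $\mathrm{RT}^1_{<\infty}$).
   Context: Setting: $\mathcal{N}=(N,\mathcal{P},+,\times,<,0,1)$ with $\mathcal{P}\subseteq 2^N$ is a (possibly nonstandard) second-order model of arithmetic; elements of $N$ are called integers and elements of $\mathcal{P}$ are called sets. $\mathcal{N}$ satisfies the base theory $F$, consisting of $P^-$ (Peano arithmetic without induction), $\mathrm{I}\Delta^0_0$ (induction for $\Delta^0_0$ formulas), the totality of exponentiation, and $\Delta^0_1$-comprehension; $F$ is also called $\mathrm{RCA}_0^*$. A formula is $\Delta^0_0$ ($=\Sigma^0_0=\Pi^0_0$) if all its quantifiers are bounded number quantifiers; $\Sigma^0_{n+1}$ formulas are a block of existential number quantifiers followed by a $\Pi^0_n$ formula, and dually for $\Pi^0_{n+1}$. Number and set parameters are allowed. A definable subset of $N$ (not necessarily in $\mathcal{P}$) is finite iff it is bounded by some integer of $N$, and infinite otherwise. The c.e. sets are the $\Sigma^0_1$-definable subsets of $N$ (parameters allowed); $W_e$ is the $e$th c.e. set, with stage-$s$ approximation $W_{e,s}$ given by $x\in W_{e,s}$ iff $\exists t<s\,T(e,x,t)$, where $T$ is Kleene's $T$-predicate. ''Computable'' means $\Delta^0_1$-definable. A finite collection of c.e. sets is a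 family $\{W_{f(i)}\mid i<n\}$ with $n\in N$ (possibly nonstandard) and $f$ a computable total function. $\mathrm{B}\Sigma^0_m$ is the scheme asserting, for every $\Sigma^0_m$ formula $P(i,b)$ and all $n\in N$: if $\forall i<n\,\exists b_i\,P(i,b_i)$ then $\exists b\,\forall i<n\,\exists b_i<b\,P(i,b_i)$. The Infinite $\Gamma$-Pigeonhole Principle asserts: if $C$ is a partial function from $N$ to some integer $k$ whose graph is $\Gamma$-definable in $\mathcal{N}$, and $X$ is an infinite subset of the domain of $C$, then there is $x<k$ such that $C^{-1}(x)\cap X$ is infinite in $\mathcal{N}$. *)

(* Defs.v *)
(** Second-order arithmetic in arbitrary (possibly nonstandard) models. *)
(* Vanilla Rocq: only the prelude is used. *)

Set Implicit Arguments.
Unset Strict Implicit.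
Unset Printing Implicit Defensive.

Record structure := Structure {
  int :> Type;
  zero : int;
  one : int;
  add : int -> int -> int;
  mul : int -> int -> int;
  lt : int -> int -> Prop;
  isset : (int -> Prop) -> Prop
}.

Arguments zero {_}.
Arguments one {_}.
Arguments isset {_}.

Declare Scope so_scope.
Delimit Scope so_scope with so.
Bind Scope so_scope with int.
Notation "x + y" := (add x y) : so_scope.
Notation "x * y" := (mul x y) : so_scope.
Notation "x < y" := (lt x y) : so_scope.
Open Scope so_scope.

(** * Formulas *)

(* Variables are de Bruijn indices.  Set variables are never quantified, so
   they only serve as set parameters. *)
Inductive term :=
| TVar (i : nat)
| TZero
| TOne
| TAdd (s t : term)
| TMul (s t : term).

(* FBAll and FBEx are the bounded quantifiers "for all x < t" and "for some
   x < t"; the bound t is evaluated outside the scope of x. *)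
Inductive formula :=
| FEq (s t : term)
| FLt (s t : term)
| FMem (t : term) (X : nat)
| FNot (phi : formula)
| FAnd (phi psi : formula)
| FOr (phi psi : formula)
| FImp (phi psi : formula)
| FBAll (t : term) (phi : formula)
| FBEx (t : term) (phi : formula)
| FAll (phi : formula)
| FEx (phi : formula).

Definition scons {T : Type} (x : T) (rho : nat -> T) (i : nat) : T :=
  match i with O => x | S j => rho j end.

Fixpoint eval {N : structure} (rho : nat -> N) (t : term) : N :=
  match t with
  | TVar i => rho i
  | TZero => zero
  | TOne => one
  | TAdd s t => eval rho s + eval rho t
  | TMul s t => eval rho s * eval rho t
  end.

Fixpoint holds {N : structure} (rho : nat -> N) (sigma : nat -> N -> Prop)
    (phi : formula) : Prop :=
  match phi with
  | FEq s t => eval rho s = eval rho t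
  | FLt s t => eval rho s < eval rho t
  | FMem t X => sigma X (eval rho t)
  | FNot phi => ~ holds rho sigma phi
  | FAnd phi psi => holds rho sigma phi /\ holds rho sigma psi
  | FOr phi psi => holds rho sigma phi \/ holds rho sigma psi
  | FImp phi psi => holds rho sigma phi -> holds rho sigma psi
  | FBAll t phi => forall x : N, x < eval rho t -> holds (scons x rho) sigma phi
  | FBEx t phi => exists x : N, x < eval rho t /\ holds (scons x rho) sigma phi
  | FAll phi => forall x : N, holds (scons x rho) sigma phi
  | FEx phi => exists x : N, holds (scons x rho) sigma phi
  end.

Fixpoint Delta0 (phi : formula) : Prop :=
  match phi with
  | FEq _ _ | FLt _ _ | FMem _ _ => True
  | FNot phi | FBAll _ phi | FBEx _ phi => Delta0 phi
  | FAnd phi psi | FOr phi psi | FImp phi psi => Delta0 phi /\ Delta0 psi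
  | FAll _ | FEx _ => False
  end.

Inductive Sigma : nat -> formula -> Prop :=
| Sigma_Delta0 phi : Delta0 phi -> Sigma 0 phi
| Sigma_Pi n phi : Pi n phi -> Sigma (S n) phi
| Sigma_ex n phi : Sigma (S n) phi -> Sigma (S n) (FEx phi)
with Pi : nat -> formula -> Prop :=
| Pi_Delta0 phi : Delta0 phi -> Pi 0 phi
| Pi_Sigma n phi : Sigma n phi -> Pi (S n) phi
| Pi_all n phi : Pi (S n) phi -> Pi (S n) (FAll phi).

(* rho and sigma supply the number and set parameters. *)
Definition definable {N : structure} (Gamma : formula -> Prop)
    (S : N -> Prop) : Prop :=
  exists phi (rho : nat -> N) (sigma : nat -> N -> Prop),
    Gamma phi /\ (forall j, isset (sigma j)) /\
    forall x, S x <-> holds (scons x rho) sigma phi.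

Definition definable2 {N : structure} (Gamma : formula -> Prop)
    (R : N -> N -> Prop) : Prop :=
  exists phi (rho : nat -> N) (sigma : nat -> N -> Prop),
    Gamma phi /\ (forall j, isset (sigma j)) /\
    forall x y, R x y <-> holds (scons x (scons y rho)) sigma phi.

(** * Coding *)

(* An injective, not surjective, pairing. *)
Definition pair {N : structure} (a b : N) : N := (a + b) * (a + b) + a.

Notation "⟨ a , b ⟩" := (pair a b) (at level 0, a at level 99, b at level 99)
  : so_scope.

(* The finite set coded by t = ⟨k, ⟨m, n⟩⟩ consists of the u < k such that
   m (u + 1) + 1 divides n (Goedel's beta-function trick). *)
Definition inset {N : structure} (u t : N) : Prop :=
  exists k m n : N, t = ⟨k, ⟨m, n⟩⟩ /\ u < k /\
    exists q : N, n = (m * (u + one) + one) * q.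

(** * The base theory *)

Record PMinus (N : structure) : Prop := {
  PM_addA : forall x y z : N, (x + y) + z = x + (y + z);
  PM_addC : forall x y : N, x + y = y + x;
  PM_mulA : forall x y z : N, (x * y) * z = x * (y * z);
  PM_mulC : forall x y : N, x * y = y * x;
  PM_distr : forall x y z : N, x * (y + z) = x * y + x * z;
  PM_add0 : forall x : N, x + zero = x;
  PM_mul0 : forall x : N, x * zero = zero;
  PM_mul1 : forall x : N, x * one = x;
  PM_lt_trans : forall x y z : N, x < y -> y < z -> x < z;
  PM_lt_irrefl : forall x : N, ~ x < x;
  PM_lt_total : forall x y : N, x < y \/ x = y \/ y < x;
  PM_lt_add : forall x y z : N, x < y -> x + z < y + z;
  PM_lt_mul : forall x y z : N, zero < z -> x < y -> x * z < y * z;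
  PM_lt_sub : forall x y : N, x < y -> exists z, x + z = y;
  PM_lt01 : (zero : N) < one;
  PM_discrete : forall x : N, zero < x -> x = one \/ one < x;
  PM_ge0 : forall x : N, x = zero \/ zero < x
}.

Definition IDelta0 (N : structure) : Prop :=
  forall S : N -> Prop, definable Delta0 S ->
    S zero -> (forall x, S x -> S (x + one)) -> forall x, S x.

(* z = x ^ y, witnessed by a coded finite set of pairs ⟨i, x ^ i⟩ that is
   closed under going from i + 1 to i.  Over PMinus and IDelta0, the totality
   of this relation is equivalent to that of any of the usual bounded
   definitions of the graph of exponentiation. *)
Definition expgraph {N : structure} (x y z : N) : Prop :=
  exists t : N, inset ⟨y, z⟩ t /\
    forall u, inset u t ->
      u = ⟨zero, one⟩ \/
      exists i w : N, inset ⟨i, w⟩ t /\ u = ⟨i + one, w * x⟩.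

Definition exp_total (N : structure) : Prop :=
  forall x y : N, exists z, expgraph x y z.

Definition Delta1_CA (N : structure) : Prop :=
  forall S : N -> Prop, definable (Sigma 1) S -> definable (Pi 1) S ->
    exists X : N -> Prop, isset X /\ forall x, X x <-> S x.

Record modelF (N : structure) : Prop := {
  F_PMinus : PMinus N;
  F_IDelta0 : IDelta0 N;
  F_exp : exp_total N;
  F_Delta1_CA : Delta1_CA N
}.

(** * Finiteness and computability *)

Definition finite {N : structure} (S : N -> Prop) : Prop :=
  exists b : N, forall x, S x -> x < b.

Definition infinite {N : structure} (S : N -> Prop) : Prop := ~ finite S.

Definition computable {N : structure} (f : N -> N) : Prop :=
  definable2 (Sigma 1) (fun i y => f i = y) /\
  definable2 (Pi 1) (fun i y => f i = y).

Fixpoint num {N : structure} (n : nat) : N :=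
  match n with O => zero | S n => num n + one end.

(* Indices of the unary functions that are partial recursive in A.  They are
   generated by composition and minimization from the constants, the identity,
   the pairing and its projections, +, *, and the characteristic functions of
   < and of A, where 0 means true.  The functions of two arguments diverge
   outside the range of the pairing.
   [justified A G c x y] says that {c}(x) = y follows in one step from the
   equations {c'}(x') = y' such that G c' x' y'. *)
Inductive justified {N : structure} (A : N -> Prop) (G : N -> N -> N -> Prop) :
    N -> N -> N -> Prop :=
| J_const a x : justified A G ⟨num 0, a⟩ x a
| J_id x : justified A G ⟨num 1, zero⟩ x x
| J_fst u v : justified A G ⟨num 2, zero⟩ ⟨u, v⟩ u
| J_snd u v : justified A G ⟨num 3, zero⟩ ⟨u, v⟩ v
| J_add u v : justified A G ⟨num 4, zero⟩ ⟨u, v⟩ (u + v)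
| J_mul u v : justified A G ⟨num 5, zero⟩ ⟨u, v⟩ (u * v)
| J_lt_true u v : u < v -> justified A G ⟨num 6, zero⟩ ⟨u, v⟩ zero
| J_lt_false u v : ~ u < v -> justified A G ⟨num 6, zero⟩ ⟨u, v⟩ one
| J_oracle_true x : A x -> justified A G ⟨num 7, zero⟩ x zero
| J_oracle_false x : ~ A x -> justified A G ⟨num 7, zero⟩ x one
| J_pair c d x u v :
    G c x u -> G d x v -> justified A G ⟨num 8, ⟨c, d⟩⟩ x ⟨u, v⟩
| J_comp c d x u y :
    G d x u -> G c u y -> justified A G ⟨num 9, ⟨c, d⟩⟩ x y
| J_mu c x y :
    G c ⟨x, y⟩ zero ->
    (forall z, z < y -> exists v, v <> zero /\ G c ⟨x, z⟩ v) ->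
    justified A G ⟨num 10, c⟩ x y.

(* t codes a finite set of equations {c}(x) = y, written ⟨c, ⟨x, y⟩⟩, each
   justified by others.  No ordering of t is needed: justification passes to
   strictly smaller indices. *)
Definition computation {N : structure} (A : N -> Prop) (t : N) : Prop :=
  forall u, inset u t -> exists c x y : N, u = ⟨c, ⟨x, y⟩⟩ /\
    justified A (fun c' x' y' => inset ⟨c', ⟨x', y'⟩⟩ t) c x y.

(* Kleene's T-predicate relative to A: t codes a computation of {e}(x). *)
Definition KleeneT {N : structure} (A : N -> Prop) (e x t : N) : Prop :=
  computation A t /\ exists y : N, inset ⟨e, ⟨x, y⟩⟩ t.

Definition Wstage {N : structure} (A : N -> Prop) (e s x : N) : Prop :=
  exists t : N, t < s /\ KleeneT A e x t.

Definition W {N : structure} (A : N -> Prop) (e x : N) : Prop :=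
  exists s : N, Wstage A e s x.

(** * The three principles *)

(* Set parameters in the definitions of c.e. sets are provided by the oracle
   A; one set is enough because the sets of a model of F are closed under
   finite joins. *)
Definition finite_union_principle (N : structure) : Prop :=
  forall A : N -> Prop, isset A ->
  forall f : N -> N, computable f ->
  forall n : N,
    (forall i, i < n -> finite (W A (f i))) ->
    finite (fun x => exists i, i < n /\ W A (f i) x).

Definition BSigma (m : nat) (N : structure) : Prop :=
  forall P : N -> N -> Prop, definable2 (Sigma m) P ->
  forall n : N,
    (forall i, i < n -> exists b, P i b) ->
    exists b, forall i, i < n -> exists bi, bi < b /\ P i bi.

(* [C y x] is the graph relation C(y) = x. *)
Definition infinite_PHP (Gamma : formula -> Prop) (N : structure) : Prop :=
  forall (k : N) (C : N -> N -> Prop),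
    (forall y x x', C y x -> C y x' -> x = x') ->
    (forall y x, C y x -> x < k) ->
    definable2 Gamma C ->
  forall X : N -> Prop, isset X -> infinite X ->
    (forall y, X y -> exists x, C y x) ->
    exists x, x < k /\ infinite (fun y => C y x /\ X y).

(* Main.v *)
(* Let g(i) be the least witness of a Sigma1 property of i < n.  The relation
   g(i) <= g(j) is Delta1, hence a set, and Delta0 induction finds a maximal j;
   so F proves Sigma1 bounding.  Together with the beta function, available
   because exponentiation is total, it merges boundedly many computations into
   one, and an external induction on Delta0 formulas then shows that every
   Sigma1 relation is uniformly c.e. in some set.

   All three principles are compared with bounding for Pi1 matrices: if every
   i < n has some b such that no c refutes (i, b), then such b can be found
   below a common bound.  It bounds unions of finite c.e. sets and of finite
   colour classes directly.  Conversely, the c.e. sets of those x such that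
   every b <= x is refuted have a bounded union; and in the colouring of s by
   the i < n whose least b not refuted before s is largest, an infinite colour
   class provides the bound. *)
From Stdlib Require Import Classical ClassicalEpsilon Ring Lia PeanoNat.
Require Import Defs.

Set Implicit Arguments.
Unset Strict Implicit.

(** * Renaming of variables *)

(** Delta0 induction is the only induction available inside the model, so an inductive claim may
    quantify only below numbers given in advance. Exponentiation enters solely as a supply of such
    numbers: Delta0 tables of powers bound the multiples and products out of which the codes of
    finite sets are built. Computations are unordered sets of justified equations, so a union of
    computations is again one, and no induction along a computation is ever made: that an index has
    the intended value is proved code by code, by recursion on formulas outside the model.
    Definability is checked on predicates of environments, closed under connectives, bounded
    quantifiers and substitution, so that a tactic can do it. *)

Fixpoint interleave {T : Type} (a b : nat -> T) (n : nat) : T :=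
  match n with
  | O => a O
  | S n => interleave b (fun i => a (S i)) n
  end.

(** Lets two formulas with separate parameters be read under one common assignment. *)
Lemma interleave_both T n : forall a b : nat -> T,
  interleave a b (n + n) = a n /\ interleave a b (S (n + n)) = b n.
Proof.
induction n as [|n IH]; intros a b; [split; reflexivity|].
rewrite <- plus_n_Sm; simpl.
destruct (IH (fun i => a (S i)) (fun i => b (S i))) as [H1 H2]; split; assumption.
Qed.

Lemma interleave_l T n (a b : nat -> T) : interleave a b (n + n) = a n.
Proof. apply interleave_both. Qed.

Lemma interleave_r T n (a b : nat -> T) : interleave a b (S (n + n)) = b n.
Proof. apply interleave_both. Qed.

Fixpoint tren (f : nat -> nat) (t : term) : term :=
  match t with
  | TVar i => TVar (f i)
  | TZero => TZero
  | TOne => TOne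
  | TAdd s t => TAdd (tren f s) (tren f t)
  | TMul s t => TMul (tren f s) (tren f t)
  end.

Definition upren (f : nat -> nat) (i : nat) : nat :=
  match i with O => O | S j => S (f j) end.

Fixpoint ren (f g : nat -> nat) (phi : formula) : formula :=
  match phi with
  | FEq s t => FEq (tren f s) (tren f t)
  | FLt s t => FLt (tren f s) (tren f t)
  | FMem t X => FMem (tren f t) (g X)
  | FNot phi => FNot (ren f g phi)
  | FAnd phi psi => FAnd (ren f g phi) (ren f g psi)
  | FOr phi psi => FOr (ren f g phi) (ren f g psi)
  | FImp phi psi => FImp (ren f g phi) (ren f g psi)
  | FBAll t phi => FBAll (tren f t) (ren (upren f) g phi)
  | FBEx t phi => FBEx (tren f t) (ren (upren f) g phi)
  | FAll phi => FAll (ren (upren f) g phi)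
  | FEx phi => FEx (ren (upren f) g phi)
  end.

Lemma ren_Delta0 phi : forall f g, Delta0 phi -> Delta0 (ren f g phi).
Proof. induction phi; simpl; intros; intuition. Qed.

Section Renaming.
Variable N : structure.

Lemma eval_tren f (rho rho' : nat -> N) t :
  (forall i, rho (f i) = rho' i) -> eval rho (tren f t) = eval rho' t.
Proof. intros H; induction t; simpl; auto; f_equal; auto. Qed.

Lemma upren_scons f (rho rho' : nat -> N) (x : N) :
  (forall i, rho (f i) = rho' i) ->
  forall i, scons x rho (upren f i) = scons x rho' i.
Proof. intros H [|i]; simpl; auto. Qed.

Lemma holds_ren phi : forall f g (rho rho' : nat -> N) sigma sigma',
  (forall i, rho (f i) = rho' i) -> (forall j, sigma (g j) = sigma' j) ->
  (holds rho sigma (ren f g phi) <-> holds rho' sigma' phi).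
Proof.
induction phi; simpl; intros f g rho rho' sigma sigma' Hr Hs;
  rewrite ?(fun t => eval_tren t Hr), ?Hs;
  try (rewrite (IHphi1 f g rho rho' sigma sigma'),
               (IHphi2 f g rho rho' sigma sigma'); auto);
  try tauto.
- rewrite (IHphi f g rho rho' sigma sigma'); tauto.
- split; intros H x Hx; apply (IHphi _ _ _ _ _ _ (upren_scons x Hr) Hs); auto.
- split; intros (x & Hx & H); exists x; split; auto;
    apply (IHphi _ _ _ _ _ _ (upren_scons x Hr) Hs); auto.
- split; intros H x; apply (IHphi _ _ _ _ _ _ (upren_scons x Hr) Hs); auto.
- split; intros (x & H); exists x;
    apply (IHphi _ _ _ _ _ _ (upren_scons x Hr) Hs); auto.
Qed.

Lemma holds_ext phi (rho rho' : nat -> N) sigma :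
  (forall i, rho i = rho' i) -> (holds rho sigma phi <-> holds rho' sigma phi).
Proof.
intros H.
rewrite <- (holds_ren phi (f := fun i => i) (g := fun i => i)
  (rho := rho) (sigma := sigma) (sigma' := sigma) H) by reflexivity.
symmetry; apply holds_ren; auto.
Qed.

End Renaming.

Section Model.
Variable N : structure.
Hypothesis HF : modelF N.

Let PM : PMinus N := F_PMinus HF.

(** * Arithmetic *)

Lemma add0l (x : N) : zero + x = x.
Proof. rewrite (PM_addC PM); apply (PM_add0 PM). Qed.

Lemma semiring :
  semi_ring_theory (zero : N) one (@add N) (@mul N) eq.
Proof.
constructor; intros.
- apply add0l.
- apply (PM_addC PM).
- symmetry; apply (PM_addA PM).
- rewrite (PM_mulC PM); apply (PM_mul1 PM).
- rewrite (PM_mulC PM); apply (PM_mul0 PM).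
- apply (PM_mulC PM).
- symmetry; apply (PM_mulA PM).
- rewrite !(PM_mulC PM _ p); apply (PM_distr PM).
Qed.

Add Ring model_ring : semiring.

Lemma lt_irrefl (x : N) : ~ x < x.
Proof. apply (PM_lt_irrefl PM). Qed.

Lemma lt_trans (x y z : N) : x < y -> y < z -> x < z.
Proof. apply (PM_lt_trans PM). Qed.

Lemma lt_total (x y : N) : x < y \/ x = y \/ y < x.
Proof. apply (PM_lt_total PM). Qed.

Lemma not_lt0 (x : N) : ~ x < zero.
Proof.
intros H; destruct (PM_ge0 PM x) as [-> | H'].
- exact (lt_irrefl H).
- exact (lt_irrefl (lt_trans H H')).
Qed.

Lemma zero_or_succ (x : N) : x = zero \/ exists y, x = y + one.
Proof.
destruct (PM_ge0 PM x) as [H | H]; [now left | right].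
destruct (PM_discrete PM H) as [-> | H'].
- exists zero; ring.
- destruct (PM_lt_sub PM H') as [z <-]; exists z; ring.
Qed.

Lemma lt_add_r (x y z : N) : x < y -> x + z < y + z.
Proof. apply (PM_lt_add PM). Qed.

(** Turns an inequality into an equation with an explicit gap, which [ring] can settle. *)
Lemma lt_ex (x y : N) : x < y <-> exists z, y = x + z + one.
Proof.
split.
- intros H; destruct (PM_lt_sub PM H) as [z Hz]; subst y.
  destruct (zero_or_succ z) as [-> | [w ->]].
  + exfalso; apply (@lt_irrefl x). now replace (x + zero) with x in H by ring.
  + exists w; ring.
- intros [z ->].
  destruct (PM_ge0 PM (z + one)) as [H | H].
  + exfalso.
    assert (Hz : zero < z + one); [|rewrite H in Hz; exact (lt_irrefl Hz)].
    destruct (PM_ge0 PM z) as [-> | Hz].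
    * rewrite add0l; apply (PM_lt01 PM).
    * apply (lt_trans (PM_lt01 PM)).
      apply (lt_add_r one) in Hz; now rewrite add0l in Hz.
  + apply (lt_add_r x) in H.
    replace (zero + x) with x in H by ring.
    now replace (x + z + one) with (z + one + x) by ring.
Qed.

Lemma add_cancel (x y z : N) : x + z = y + z -> x = y.
Proof.
intros H; destruct (lt_total x y) as [L | [-> | L]]; auto;
  apply (lt_add_r z) in L; rewrite H in L; now apply lt_irrefl in L.
Qed.

Lemma add_cancel_l (x y z : N) : z + x = z + y -> x = y.
Proof. rewrite !(PM_addC PM z); apply add_cancel. Qed.

(** The signature has only the strict order; the weak one is written [x < y + one] throughout, the
    form that bounded quantifiers accept. *)
Lemma le_ex (x y : N) : x < y + one <-> exists z, y = x + z.
Proof.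
rewrite lt_ex; split; intros [z H]; exists z.
- now apply add_cancel in H.
- now rewrite H.
Qed.

Lemma succ_neq0 (x : N) : x + one <> zero.
Proof.
intros H; apply (@not_lt0 x); rewrite <- H; apply lt_ex; exists zero; ring.
Qed.

Lemma one_neq0 : (one : N) <> zero.
Proof. intros E; apply (@succ_neq0 zero); now rewrite add0l. Qed.

Lemma add_eq0_r (x y : N) : x + y = zero -> y = zero.
Proof.
intros H; destruct (zero_or_succ y) as [-> | [z ->]]; auto.
exfalso; apply (@succ_neq0 (x + z)); rewrite <- H; ring.
Qed.

Lemma lt_succ (x : N) : x < x + one.
Proof. apply lt_ex; exists zero; ring. Qed.

Lemma lt_S (x y : N) : x < y -> x < y + one.
Proof. intros H; exact (lt_trans H (lt_succ y)). Qed.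

Lemma le_cases (x y : N) : x < y + one -> x < y \/ x = y.
Proof.
intros H; apply le_ex in H as [z ->].
destruct (zero_or_succ z) as [-> | [w ->]].
- right; ring.
- left; apply lt_ex; exists w; ring.
Qed.

Lemma lt_le_trans (x y z : N) : x < y -> y < z + one -> x < z.
Proof.
intros H1 H2; destruct (le_cases H2) as [H | <-]; [exact (lt_trans H1 H) | auto].
Qed.

Lemma le_lt_trans (x y z : N) : x < y + one -> y < z -> x < z.
Proof.
intros H1 H2; destruct (le_cases H1) as [H | ->]; [exact (lt_trans H H2) | auto].
Qed.

Lemma le_trans (x y z : N) : x < y + one -> y < z + one -> x < z + one.
Proof. intros H1 H2; exact (le_lt_trans H1 H2). Qed.

Lemma lt_succ_mono (x y : N) : x < y -> x + one < y + one.
Proof. apply lt_add_r. Qed.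

Lemma not_lt_le (x y : N) : ~ x < y -> y < x + one.
Proof.
intros H; destruct (lt_total x y) as [L | [-> | L]]; [tauto | apply lt_succ | now apply lt_S].
Qed.

Lemma le_mul_r (x y : N) : y <> zero -> x < x * y + one.
Proof.
intros H; destruct (zero_or_succ y) as [-> | [z ->]]; [tauto|].
apply le_ex; exists (x * z); ring.
Qed.

Lemma mul_eq0 (x y : N) : x * y = zero -> x = zero \/ y = zero.
Proof.
destruct (zero_or_succ x) as [-> | [x' ->]]; auto.
destruct (zero_or_succ y) as [-> | [y' ->]]; auto.
intros H; exfalso; apply (@succ_neq0 (x' * y' + x' + y')); rewrite <- H; ring.
Qed.

Lemma pair_le_l (a b : N) : a < ⟨a, b⟩ + one.
Proof. apply le_ex; unfold pair; exists ((a + b) * (a + b)); ring. Qed.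

Lemma pair_le_r (a b : N) : b < ⟨a, b⟩ + one.
Proof.
apply le_ex; unfold pair; destruct (zero_or_succ b) as [-> | [z ->]].
- exists (a * a + a); ring.
- exists (a * a + a * z + a * z + a + a + z * z + z + a); ring.
Qed.

(** The code lies between the consecutive squares of [a + b] and [a + b + one], so it determines the
    sum first and then [a]. *)
Lemma pair_inj (a b c d : N) : ⟨a, b⟩ = ⟨c, d⟩ -> a = c /\ b = d.
Proof.
assert (Hne : forall x y z w : N, x + y < z + w -> ⟨x, y⟩ <> ⟨z, w⟩).
{ intros x y z w L H; apply lt_ex in L as [v Hv]; unfold pair in H.
  rewrite Hv in H.
  apply (@lt_irrefl ((x + y) * (x + y) + x)); rewrite H at 2.
  apply lt_ex.
  exists (y + (x + y) * (v + v) + v * v + v + v + x + y + z); ring. }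
intros H; destruct (lt_total (a + b) (c + d)) as [L | [E | L]].
- apply Hne in L; contradiction.
- unfold pair in H; rewrite E in H; apply add_cancel_l in H; subst c.
  now apply add_cancel_l in E.
- apply Hne in L; symmetry in H; contradiction.
Qed.

(** * Definability with parameters *)

Definition inst (a : nat -> nat + N) (rho : nat -> N) (i : nat) : N :=
  match a i with inl j => rho j | inr c => c end.

Definition Tm (f : (nat -> N) -> N) : Prop :=
  exists t a, forall rho, f rho = eval (inst a rho) t.

(* Predicates on environments, so that the free variables of the formula are
   either coordinates of the environment or parameters. *)
Definition D0 (P : (nat -> N) -> Prop) : Prop :=
  exists phi a (sigma : nat -> N -> Prop),
    Delta0 phi /\ (forall j, isset (sigma j)) /\
    forall rho, P rho <-> holds (inst a rho) sigma phi.

Lemma D0_ext P Q : (forall rho, P rho <-> Q rho) -> D0 P -> D0 Q.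
Proof.
intros H (phi & a & sigma & H1 & H2 & H3).
exists phi, a, sigma; split; [auto | split; [auto|]].
intros rho; rewrite <- H; apply H3.
Qed.

Lemma inst_l a b (rho : nat -> N) i :
  inst (interleave a b) rho (i + i) = inst a rho i.
Proof. unfold inst; now rewrite interleave_l. Qed.

Lemma inst_r a b (rho : nat -> N) i :
  inst (interleave a b) rho (S (i + i)) = inst b rho i.
Proof. unfold inst; now rewrite interleave_r. Qed.

Lemma Tm_var i : Tm (fun rho => rho i).
Proof. exists (TVar 0), (fun _ => inl i); reflexivity. Qed.

Lemma Tm_const c : Tm (fun _ => c).
Proof. exists (TVar 0), (fun _ => inr c); reflexivity. Qed.

Lemma Tm_shift f : Tm f -> Tm (fun rho => f (fun i => rho (S i))).
Proof.
intros (t & a & H).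
exists t, (fun i => match a i with inl j => inl (S j) | inr c => inr c end).
intros rho; rewrite H.
transitivity (eval (inst a (fun i => rho (S i))) (tren (fun i => i) t)).
- symmetry; now apply eval_tren.
- apply eval_tren; intros i; unfold inst; destruct (a i); reflexivity.
Qed.

Lemma Tm_merge f g : Tm f -> Tm g ->
  exists a s t, forall rho, f rho = eval (inst a rho) s /\ g rho = eval (inst a rho) t.
Proof.
intros (s & a & Hs) (t & b & Ht).
exists (interleave a b), (tren (fun i => i + i)%nat s), (tren (fun i => S (i + i)) t).
intros rho; split.
- rewrite Hs; symmetry; apply eval_tren; intros; apply inst_l.
- rewrite Ht; symmetry; apply eval_tren; intros; apply inst_r.
Qed.

Lemma Tm_add f g : Tm f -> Tm g -> Tm (fun rho => f rho + g rho).
Proof.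
intros Hf Hg; destruct (Tm_merge Hf Hg) as (a & s & t & H).
exists (TAdd s t), a; intros rho; simpl; destruct (H rho) as [-> ->]; reflexivity.
Qed.

Lemma Tm_mul f g : Tm f -> Tm g -> Tm (fun rho => f rho * g rho).
Proof.
intros Hf Hg; destruct (Tm_merge Hf Hg) as (a & s & t & H).
exists (TMul s t), a; intros rho; simpl; destruct (H rho) as [-> ->]; reflexivity.
Qed.

Lemma Tm_code f g : Tm f -> Tm g -> Tm (fun rho => ⟨f rho, g rho⟩).
Proof.
intros Hf Hg; apply (Tm_add (f := fun rho => (f rho + g rho) * (f rho + g rho))); auto.
apply Tm_mul; now apply Tm_add.
Qed.

Lemma D0_merge P Q : D0 P -> D0 Q -> exists a sigma phi psi,
  (forall j, isset (sigma j)) /\ Delta0 phi /\ Delta0 psi /\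
  forall rho, (P rho <-> holds (inst a rho) sigma phi) /\
              (Q rho <-> holds (inst a rho) sigma psi).
Proof.
intros (phi & a & sigma & H1 & H2 & H3) (psi & b & tau & K1 & K2 & K3).
exists (interleave a b), (interleave sigma tau),
  (ren (fun i => i + i)%nat (fun i => i + i)%nat phi),
  (ren (fun i => S (i + i)) (fun i => S (i + i)) psi).
repeat split; try (now apply ren_Delta0).
- assert (HI : forall j a b, (forall j, @isset N (a j)) -> (forall j, isset (b j)) ->
    isset (interleave a b j)).
  { clear; induction j; simpl; intros; auto. }
  auto.
- rewrite (@holds_ren N phi _ _ _ (inst a rho) _ sigma); [apply H3| |];
    intros; [apply inst_l | apply interleave_l].
- rewrite (@holds_ren N phi _ _ _ (inst a rho) _ sigma); [apply H3| |];
    intros; [apply inst_l | apply interleave_l].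
- rewrite (@holds_ren N psi _ _ _ (inst b rho) _ tau); [apply K3| |];
    intros; [apply inst_r | apply interleave_r].
- rewrite (@holds_ren N psi _ _ _ (inst b rho) _ tau); [apply K3| |];
    intros; [apply inst_r | apply interleave_r].
Qed.

Lemma D0_not P : D0 P -> D0 (fun rho => ~ P rho).
Proof.
intros (phi & a & sigma & H1 & H2 & H3); exists (FNot phi), a, sigma.
split; [auto|].
split; [auto|]; intros rho; simpl; rewrite H3; tauto.
Qed.

Lemma D0_and P Q : D0 P -> D0 Q -> D0 (fun rho => P rho /\ Q rho).
Proof.
intros HP HQ; destruct (D0_merge HP HQ) as (a & sigma & phi & psi & H1 & H2 & H3 & H).
exists (FAnd phi psi), a, sigma; split; [simpl; auto|].
split; [auto|]; intros rho; simpl; destruct (H rho); tauto.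
Qed.

Lemma D0_or P Q : D0 P -> D0 Q -> D0 (fun rho => P rho \/ Q rho).
Proof.
intros HP HQ; apply D0_ext with (fun rho => ~ (~ P rho /\ ~ Q rho)).
- intros rho; destruct (classic (P rho)); tauto.
- apply D0_not, D0_and; now apply D0_not.
Qed.

Lemma D0_imp P Q : D0 P -> D0 Q -> D0 (fun rho => P rho -> Q rho).
Proof.
intros HP HQ; apply D0_ext with (fun rho => ~ P rho \/ Q rho).
- intros rho; destruct (classic (P rho)); tauto.
- apply D0_or; auto; now apply D0_not.
Qed.

Lemma D0_iff P Q : D0 P -> D0 Q -> D0 (fun rho => P rho <-> Q rho).
Proof. intros; apply D0_and; now apply D0_imp. Qed.

(** The map [g] may permute coordinates and fix some of them as parameters; this is how variables
    are brought into the order that a quantifier lemma expects. *)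
Lemma D0_env P (e : nat -> nat + N) (g : (nat -> N) -> nat -> N) :
  (forall rho i, g rho i = inst e rho i) -> D0 P -> D0 (fun rho => P (g rho)).
Proof.
intros He (phi & a & sigma & H1 & H2 & H3).
exists phi, (fun i => match a i with inl j => e j | inr c => inr c end), sigma.
repeat split; auto.
- intros H; apply H3 in H; eapply holds_ext; [|exact H].
  intros i; unfold inst at 1 2; destruct (a i); auto; now rewrite He.
- intros H; apply H3; eapply holds_ext; [|exact H].
  intros i; unfold inst at 1 2; destruct (a i); auto; now rewrite He.
Qed.

Section WithSet.
(* A model of F without any set satisfies all three principles vacuously; in
   a model with a set, the unused set variables can be interpreted by it. *)
Variable X0 : N -> Prop.
Hypothesis X0_set : isset X0.

(** * Closure properties of Delta0 predicates *)

Lemma D0_eq f g : Tm f -> Tm g -> D0 (fun rho => f rho = g rho).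
Proof.
intros Hf Hg; destruct (Tm_merge Hf Hg) as (a & s & t & H).
exists (FEq s t), a, (fun _ => X0); split; [exact I|].
split; [auto|]; intros rho; simpl; destruct (H rho) as [-> ->]; tauto.
Qed.

Lemma D0_lt f g : Tm f -> Tm g -> D0 (fun rho => f rho < g rho).
Proof.
intros Hf Hg; destruct (Tm_merge Hf Hg) as (a & s & t & H).
exists (FLt s t), a, (fun _ => X0); split; [exact I|].
split; [auto|]; intros rho; simpl; destruct (H rho) as [-> ->]; tauto.
Qed.

Lemma D0_mem X f : isset X -> Tm f -> D0 (fun rho => X (f rho)).
Proof.
intros HX (t & a & H).
exists (FMem t 0), a, (fun _ => X); split; [exact I|].
split; [auto|]; intros rho; simpl; rewrite H; tauto.
Qed.

Lemma D0_bex (Q : N -> (nat -> N) -> Prop) f :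
  Tm f -> D0 (fun rho => Q (rho 0) (fun i => rho (S i))) ->
  D0 (fun rho => exists x, x < f rho /\ Q x rho).
Proof.
intros (t & b & Ht) (phi & a & sigma & H1 & H2 & H3).
(* Several variables of [phi] may denote coordinate 0. The renaming [r] collapses them all to the
   bound variable, while [a'] lowers the other coordinates and holds zero as a placeholder. *)
pose (a' := fun i => match a i with inl O => inr zero | inl (S j) => inl j | inr c => inr c end).
pose (r := fun i => match a i with inl O => O | _ => S (i + i) end).
exists (FBEx (tren (fun i => S (i + i)) t) (ren r (fun i => i) phi)),
  (interleave a' b), sigma.
assert (K : forall rho x, holds (scons x (inst (interleave a' b) rho)) sigma
    (ren r (fun i => i) phi) <-> Q x rho).
{ intros rho x.
  rewrite (@holds_ren N phi r (fun i => i) _ (inst a (scons x rho)) _ sigma); auto.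
  - symmetry; apply (H3 (scons x rho)).
  - intros i; unfold r.
    destruct (a i) as [[|j]|c] eqn:E; cbn [scons]; rewrite ?inst_l;
      unfold inst, a'; rewrite E; reflexivity. }
simpl; repeat split; auto.
- now apply ren_Delta0.
- intros (x & Hx & H); exists x; split; [|now apply K].
  rewrite (@eval_tren N _ _ (inst b rho)), <- Ht; [exact Hx|]; intros; apply inst_r.
- intros (x & Hx & H); exists x; split; [|now apply K].
  rewrite (@eval_tren N _ _ (inst b rho)), <- Ht in Hx; [exact Hx|]; intros; apply inst_r.
Qed.

Lemma D0_ball (Q : N -> (nat -> N) -> Prop) f :
  Tm f -> D0 (fun rho => Q (rho 0) (fun i => rho (S i))) ->
  D0 (fun rho => forall x, x < f rho -> Q x rho).
Proof.
intros Hf HQ; apply D0_ext with (fun rho => ~ exists x, x < f rho /\ ~ Q x rho).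
- intros rho; split.
  + intros H x Hx; apply NNPP; intros K; apply H; exists x; auto.
  + intros H (x & Hx & K); auto.
- apply D0_not, D0_bex; auto; now apply D0_not.
Qed.

Lemma D0_ex (f : (nat -> N) -> N) (Q : N -> (nat -> N) -> Prop) :
  (forall rho x, Q x rho -> x < f rho) ->
  Tm f -> D0 (fun rho => Q (rho 0) (fun i => rho (S i))) ->
  D0 (fun rho => exists x, Q x rho).
Proof.
intros H Hf HQ; eapply D0_ext; [|exact (D0_bex Hf HQ)].
intros rho; split; [intros (x & _ & K) | intros (x & K)]; exists x; auto.
Qed.

Lemma D0_all (f : (nat -> N) -> N) (Q : N -> (nat -> N) -> Prop) :
  (forall rho x, ~ Q x rho -> x < f rho) ->
  Tm f -> D0 (fun rho => Q (rho 0) (fun i => rho (S i))) ->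
  D0 (fun rho => forall x, Q x rho).
Proof.
intros H Hf HQ; eapply D0_ext; [|exact (D0_ball Hf HQ)].
intros rho; split; auto.
intros K x; apply NNPP; intros L; exact (L (K x (H _ _ L))).
Qed.

(** Substitution is expressed by a quantifier bounded by the term itself, so that terms need not be
    substituted into formulas. *)
Lemma D0_subst (P : N -> (nat -> N) -> Prop) f :
  D0 (fun rho => P (rho 0) (fun i => rho (S i))) -> Tm f ->
  D0 (fun rho => P (f rho) rho).
Proof.
intros HP Hf; apply D0_ext with (fun rho => exists x, x < f rho + one /\ x = f rho /\ P x rho).
- intros rho; split; [intros (x & _ & -> & H); auto|].
  intros H; exists (f rho); split; [apply lt_succ | auto].
- apply D0_bex; [apply Tm_add; auto; apply Tm_const|].
  apply D0_and; auto; apply D0_eq; [apply Tm_var|].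
  now apply (@Tm_shift f).
Qed.

Definition D0_1 (R : N -> Prop) : Prop := D0 (fun rho => R (rho 0)).
Definition D0_2 (R : N -> N -> Prop) : Prop := D0 (fun rho => R (rho 0) (rho 1)).
Definition D0_3 (R : N -> N -> N -> Prop) : Prop :=
  D0 (fun rho => R (rho 0) (rho 1) (rho 2)).

Lemma D0_rel1 R f : D0_1 R -> Tm f -> D0 (fun rho => R (f rho)).
Proof.
intros H Hf; apply (@D0_subst (fun x rho => R x)); auto.
Qed.

Lemma D0_rel2 R f g : D0_2 R -> Tm f -> Tm g -> D0 (fun rho => R (f rho) (g rho)).
Proof.
intros H Hf Hg; apply (@D0_subst (fun x rho => R x (g rho))); auto.
apply (@D0_subst (fun y rho => R (rho 0) y)); [|now apply (@Tm_shift g)].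
apply (@D0_env (fun rho => R (rho 0) (rho 1))
  (fun i => match i with 0 => inl 1 | 1 => inl 0 | _ => inl i end)
  (fun rho => scons (rho 1) (scons (rho 0) (fun i => rho (S (S i)))))); [|exact H].
intros rho [|[|i]]; reflexivity.
Qed.

Lemma D0_rel3 R f g h : D0_3 R -> Tm f -> Tm g -> Tm h ->
  D0 (fun rho => R (f rho) (g rho) (h rho)).
Proof.
intros H Hf Hg Hh; apply (@D0_subst (fun x rho => R x (g rho) (h rho))); auto.
apply (@D0_subst (fun y rho => R (rho 0) y (h (fun i => rho (S i)))));
  [|now apply (@Tm_shift g)].
apply (@D0_subst (fun z rho => R (rho 1) (rho 0) z));
  [|now apply (@Tm_shift (fun rho => h (fun i => rho (S i)))), (@Tm_shift h)].
apply (@D0_env (fun rho => R (rho 0) (rho 1) (rho 2))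
  (fun i => match i with 0 => inl 2 | 2 => inl 0 | _ => inl i end)
  (fun rho => scons (rho 2) (scons (rho 1) (scons (rho 0) (fun i => rho (S (S (S i)))))))); [|exact H].
intros rho [|[|[|i]]]; reflexivity.
Qed.

Ltac tm := repeat (cbn beta; first
  [apply Tm_var | apply Tm_const | apply Tm_code | apply Tm_add | apply Tm_mul]).

(** Components do not exceed their pair, so unpacking a pair costs only bounded quantifiers. *)
Lemma D0_ex_pair (Q : N -> N -> (nat -> N) -> Prop) f :
  D0 (fun rho => Q (rho 1) (rho 0) (fun i => rho (S (S i)))) -> Tm f ->
  D0 (fun rho => exists a b, f rho = ⟨a, b⟩ /\ Q a b rho).
Proof.
intros HQ Hf.
apply (D0_ex (f := fun rho => f rho + one)).
{ intros rho a (b & -> & _); apply pair_le_l. }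
{ now apply Tm_add; [|apply Tm_const]. }
apply (D0_ex (f := fun rho => f (fun i => rho (S i)) + one)).
{ intros rho b (-> & _); apply pair_le_r. }
{ now apply Tm_add; [apply Tm_shift|apply Tm_const]. }
apply D0_and; auto; apply D0_eq; [|tm].
apply (@Tm_shift (fun rho => f (fun i => rho (S i)))); now apply Tm_shift.
Qed.

(** A hook, redefined each time a further relation has been shown to be Delta0. *)
Ltac d0_atom := fail.

Ltac d0 := repeat (cbn beta; first
  [ d0_atom
  | match goal with
    | H : D0_1 _ |- _ => apply (D0_rel1 H); solve [tm]
    | H : D0_2 _ |- _ => apply (D0_rel2 H); solve [tm]
    | H : D0_3 _ |- _ => apply (D0_rel3 H); solve [tm]
    | H : isset ?X |- D0 (fun rho => ?X _) => apply (D0_mem H); solve [tm]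
    end
  | apply D0_not | apply D0_iff | apply D0_and | apply D0_or
  | apply D0_eq; tm | apply D0_lt; tm
  | apply D0_ex_pair; [|solve [tm]]
  | apply D0_bex; [solve [tm]|] | apply D0_ball; [solve [tm]|]
  | apply D0_imp ]).

(** The way back from environments to formulas: variables for the three arguments come first,
    constants become parameters, and coordinates beyond the third, on which [R] does not depend, are
    set to zero. *)
Lemma D0_formula R : D0_3 R -> exists phi rho sigma,
  Delta0 phi /\ (forall j, isset (sigma j)) /\
  forall x y z : N, R x y z <-> holds (scons x (scons y (scons z rho))) sigma phi.
Proof.
intros (phi & a & sigma & H1 & H2 & H3).
exists (ren (fun i => match a i with
    inl O => 0 | inl (S O) => 1 | inl (S (S O)) => 2 | _ => S (S (S i)) end)%nat
    (fun j => j) phi),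
  (fun i => match a i with inr c => c | inl _ => zero end), sigma.
split; [now apply ren_Delta0 | split; [auto|]]; intros x y z.
rewrite (@holds_ren N phi _ _ _
  (inst a (scons x (scons y (scons z (fun _ => zero))))) _ sigma);
  [apply (H3 (scons x (scons y (scons z (fun _ => zero)))))| |auto].
intros i; unfold inst; destruct (a i) as [[|[|[|j]]]|c] eqn:E; simpl; rewrite ?E; auto.
Qed.

Lemma Delta0_Pi1 phi : Delta0 phi -> Pi 1 phi.
Proof. intros; now apply Pi_Sigma, Sigma_Delta0. Qed.

Lemma Delta0_Sigma1 phi : Delta0 phi -> Sigma 1 phi.
Proof. intros; now apply Sigma_Pi, Pi_Delta0. Qed.

Lemma definable_Delta0 R : D0_1 R -> definable Delta0 R.
Proof.
intros H; destruct (@D0_formula (fun x _ _ => R x) H) as (phi & rho & sigma & H1 & H2 & H3).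
exists phi, (scons zero (scons zero rho)), sigma; repeat split; auto; apply H3; exact zero.
Qed.

Lemma definable_Sigma1 R : D0_2 R -> definable (Sigma 1) (fun x => exists z, R z x).
Proof.
intros H; destruct (@D0_formula (fun z x _ => R z x) H) as (phi & rho & sigma & H1 & H2 & H3).
exists (FEx phi), (scons zero rho), sigma; split; [|split; auto].
- now apply Sigma_ex, Delta0_Sigma1.
- intros x; split; intros (z & Hz); exists z; now apply (H3 z x zero).
Qed.

Lemma definable_Pi1 R : D0_2 R -> definable (Pi 1) (fun x => forall z, R z x).
Proof.
intros H; destruct (@D0_formula (fun z x _ => R z x) H) as (phi & rho & sigma & H1 & H2 & H3).
exists (FAll phi), (scons zero rho), sigma; split; [|split; auto].
- now apply Pi_all, Delta0_Pi1.
- intros x; split; intros Hz z; apply (H3 z x zero), Hz.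
Qed.

Lemma definable2_Delta0 R (Gamma : formula -> Prop) :
  (forall phi, Delta0 phi -> Gamma phi) -> D0_2 R -> definable2 Gamma R.
Proof.
intros HG H; destruct (@D0_formula (fun x y _ => R x y) H) as (phi & rho & sigma & H1 & H2 & H3).
exists phi, (scons zero rho), sigma; split; [auto | split; [auto|]].
intros x y; exact (H3 x y zero).
Qed.

Lemma definable2_Sigma2 R : D0_3 R -> definable2 (Sigma 2) (fun x y => forall z, R z x y).
Proof.
intros H; destruct (D0_formula H) as (phi & rho & sigma & H1 & H2 & H3).
exists (FAll phi), rho, sigma; split; [|split; auto].
- now apply Sigma_Pi, Pi_all, Delta0_Pi1.
- intros x y; split; intros Hz z; apply (H3 z x y), Hz.
Qed.

(** * Delta0 induction and least elements *)

Lemma D0_induction S : D0_1 S ->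
  S zero -> (forall x, S x -> S (x + one)) -> forall x, S x.
Proof. intros H; apply (F_IDelta0 HF); now apply definable_Delta0. Qed.

Ltac by_induction :=
  match goal with |- forall x, @?P x => apply (@D0_induction P); unfold D0_1 end.

Lemma D0_least S : D0_1 S -> forall x, S x -> exists y, S y /\ forall z, z < y -> ~ S z.
Proof.
intros HS x Hx; apply NNPP; intros Hn.
assert (H : forall x, forall z, z < x -> ~ S z).
{ by_induction.
  - d0.
  - intros z Hz; now apply not_lt0 in Hz.
  - intros y IH z Hz Sz; apply le_cases in Hz as [Hz | ->]; [now apply (IH z)|].
    apply Hn; now exists y. }
exact (H (x + one) x (lt_succ x) Hx).
Qed.

(** * Coding of finite sets *)

(** Makes every quantifier over the elements of a coded set a bounded one. *)
Lemma inset_bound (u t : N) : inset u t -> u < t.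
Proof.
intros (k & m & n & -> & H & _); exact (lt_le_trans H (pair_le_l _ _)).
Qed.

Lemma D0_inset f g : Tm f -> Tm g -> D0 (fun rho => inset (f rho) (g rho)).
Proof.
intros Hf Hg; apply (D0_rel2 (R := @inset N)); auto.
unfold D0_2, inset.
apply (D0_ex (f := fun rho => rho 1 + one)); [|tm|].
{ intros rho k (m & n & -> & _); apply pair_le_l. }
apply (D0_ex (f := fun rho => rho 2 + one)); [|tm|].
{ intros rho m (n & -> & _); exact (le_trans (pair_le_l _ _) (pair_le_r _ _)). }
apply (D0_ex (f := fun rho => rho 3 + one)); [|tm|].
{ intros rho n (-> & _); exact (le_trans (pair_le_r _ _) (pair_le_r _ _)). }
d0.
apply (D0_ex (f := fun rho => rho 0 + one)); [|tm|d0].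
intros rho q ->; rewrite (PM_mulC PM); apply le_mul_r, succ_neq0.
Qed.

Ltac d0_atom ::= apply D0_inset; [solve [tm]|solve [tm]].

(** A Delta0 graph of the powers of [x] up to exponent [y], with all values below [M]. Later
    inductions on [j] take any [e] with [E j e] as the bound for the number they construct. *)
Lemma power_table (x y : N) : exists (E : N -> N -> Prop) (M : N),
  D0_2 E /\ (forall i w, E i w -> w < M) /\
  (forall w, E zero w -> w = one) /\
  (forall i w, E (i + one) w -> exists w', E i w' /\ w = w' * x) /\
  (forall i, i < y + one -> exists w, E i w).
Proof.
destruct (F_exp HF x y) as (z & t & Hyz & Ht).
exists (fun i w => inset ⟨i, w⟩ t), t.
assert (HS : forall i w, inset ⟨i + one, w⟩ t -> exists w', inset ⟨i, w'⟩ t /\ w = w' * x).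
{ intros i w Hw; destruct (Ht _ Hw) as [E | (j & w' & H & E)].
  - apply pair_inj in E as [E _]; now apply succ_neq0 in E.
  - apply pair_inj in E as [E ->]; apply add_cancel in E; subst j; eauto. }
split; [apply D0_inset; tm|].
split; [intros i w Hw; exact (le_lt_trans (pair_le_r _ _) (inset_bound Hw))|].
split.
{ intros w Hw; destruct (Ht _ Hw) as [E | (j & w' & H & E)].
  - now apply pair_inj in E.
  - apply pair_inj in E as [E _]; symmetry in E; now apply succ_neq0 in E. }
split; [exact HS|].
(* The witness is closed only under lowering the exponent, so the induction is on the distance [j]
   from the top; the bound [t] keeps the claim Delta0. *)
assert (H : forall j, forall i, i < t -> i + j = y -> exists w, w < t /\ inset ⟨i, w⟩ t).
{ by_induction.
  - d0.
  - intros i _ Hi; exists z; replace i with y by (rewrite <- Hi; ring).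
    split; auto; exact (le_lt_trans (pair_le_r _ _) (inset_bound Hyz)).
  - intros j IH i Hi Hy; destruct (IH (i + one)) as (w & _ & Hw).
    + apply (le_lt_trans (y := y)).
      * apply le_ex; exists j; rewrite <- Hy; ring.
      * exact (le_lt_trans (pair_le_l _ _) (inset_bound Hyz)).
    + rewrite <- Hy; ring.
    + apply HS in Hw as (w' & Hw & _); exists w'; split; auto.
      exact (le_lt_trans (pair_le_r _ _) (inset_bound Hw)). }
intros i Hi; pose proof Hi as Hi'; apply le_ex in Hi' as [j Hj].
destruct (H j i) as (w & _ & Hw); [|now rewrite Hj|eauto].
apply (le_lt_trans Hi); exact (le_lt_trans (pair_le_l _ _) (inset_bound Hyz)).
Qed.

Lemma le_mul2 (x y z w : N) : x < y + one -> z < w + one -> x * z < y * w + one.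
Proof.
rewrite !le_ex; intros [a ->] [b ->]; exists (x * b + a * z + a * b); ring.
Qed.

Lemma mul_neq0 (x y : N) : x <> zero -> y <> zero -> x * y <> zero.
Proof. intros Hx Hy H; now apply mul_eq0 in H as [H | H]. Qed.

(** A stand-in for the factorial of [k]: each step multiplies by [j + one], which is at most [k], so
    the powers of [k] bound the multiples built so far. *)
Lemma common_multiple (k : N) : exists m, m <> zero /\
  forall w, w < k + one -> w <> zero -> exists q, m = w * q.
Proof.
destruct (power_table k k) as (E & M & HE & HM & E0 & ES & Etot).
assert (H : forall j, j < k + one -> forall e, e < M -> E j e ->
  exists m, m < e + one /\ (m <> zero /\
    forall w, w < j + one -> w <> zero -> exists q, q < m + one /\ m = w * q)).
{ by_induction.
  - d0.
  - intros _ e _ He; rewrite (E0 _ He); exists one; split; [apply lt_succ|].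
    split; [apply one_neq0|].
    intros w Hw Hw0; exists one; split; [apply lt_succ|].
    apply le_cases in Hw as [Hw | Hw]; [now apply not_lt0 in Hw | contradiction].
  - intros j IH Hj e _ He; apply ES in He as (e' & He' & ->).
    destruct (IH (lt_trans (lt_succ j) Hj) e' (HM _ _ He') He') as (m & Hm & Hm0 & Hd).
    exists (m * (j + one)); split; [now apply le_mul2|].
    split; [apply mul_neq0; auto; apply succ_neq0|].
    intros w Hw Hw0; apply le_cases in Hw as [Hw | ->].
    + destruct (Hd w Hw Hw0) as (q & Hq & ->).
      exists (q * (j + one)); split; [|ring].
      replace (w * q * (j + one)) with ((q * (j + one)) * w) by ring.
      now apply le_mul_r.
    + exists m; split; [apply le_mul_r, succ_neq0 | ring]. }
destruct (Etot k (lt_succ k)) as [e He].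
destruct (H k (lt_succ k) e (HM _ _ He) He) as (m & _ & Hm0 & Hd).
exists m; split; auto.
intros w Hw Hw0; destruct (Hd w Hw Hw0) as (q & _ & Hq); eauto.
Qed.

Lemma dvd_sub (d q n x : N) : d * q = d * n + x -> exists q', x = d * q'.
Proof.
intros H; destruct (lt_total q n) as [L | [-> | L]].
- apply lt_ex in L as [z ->]; exists zero.
  replace (d * q) with (zero + d * q) in H by ring.
  replace (d * (q + z + one) + x) with (d * (z + one) + x + d * q) in H by ring.
  apply add_cancel in H; symmetry in H; apply add_eq0_r in H as ->; ring.
- exists zero; replace (d * n) with (d * n + zero) in H at 1 by ring.
  apply add_cancel_l in H as <-; ring.
- apply lt_ex in L as [z ->]; exists (z + one).
  replace (d * (n + z + one)) with (d * n + d * (z + one)) in H by ring.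
  now apply add_cancel_l in H as <-.
Qed.

(** Modulo [m * (u + one) + one], the number [m] is invertible: its product with [u + one] is
    congruent to -1. *)
Lemma dvd_cancel_base (m u q n a : N) :
  n * m * a = (m * (u + one) + one) * q ->
  exists q', n * a = (m * (u + one) + one) * q'.
Proof.
intros H; apply (@dvd_sub _ (n * a) (q * (u + one)) _).
replace ((m * (u + one) + one) * (q * (u + one)))
  with ((m * (u + one) + one) * q * (u + one)) by ring.
rewrite <- H; ring.
Qed.

(* The moduli of the beta function are pairwise coprime: the difference
   m * (v - u) of two of them divides m * m, and m is prime to each. *)
Lemma dvd_cancel_modulus (m k u v n q : N) :
  (forall w, w < k + one -> w <> zero -> exists r, m = w * r) ->
  u < k -> v < k -> u <> v ->
  n * (m * (v + one) + one) = (m * (u + one) + one) * q ->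
  exists q', n = (m * (u + one) + one) * q'.
Proof.
intros Hm Hu Hv Huv H.
assert (K : exists z, z + one < k + one /\
  exists q', n * m * (z + one) = (m * (u + one) + one) * q').
{ destruct (lt_total u v) as [L | [L | L]]; [|contradiction|];
    apply lt_ex in L as [z ->]; exists z; (split; [apply lt_succ_mono|]).
  - apply (le_lt_trans (y := u + z + one)); auto; apply le_ex; exists (u + one); ring.
  - apply (@dvd_sub _ q n); rewrite <- H; ring.
  - apply (le_lt_trans (y := v + z + one)); auto; apply le_ex; exists (v + one); ring.
  - apply (@dvd_sub _ n q); rewrite <- H; ring. }
destruct K as (z & Hz & q' & K).
apply dvd_cancel_base in K as (q2 & K).
destruct (Hm (z + one) Hz (@succ_neq0 _)) as (r & Hr).
destruct (@dvd_cancel_base m u (q2 * r) n one) as (q3 & K3).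
- replace (n * m * one) with (n * m) by ring; rewrite Hr at 1.
  transitivity (n * (z + one) * r); [ring | rewrite K; ring].
- exists q3; rewrite <- K3; ring.
Qed.

Lemma inset_code (k m n u : N) :
  inset u ⟨k, ⟨m, n⟩⟩ <-> u < k /\ exists q, n = (m * (u + one) + one) * q.
Proof.
split.
- intros (k' & m' & n' & E & H); apply pair_inj in E as [-> E].
  apply pair_inj in E as [-> ->]; auto.
- intros H; exists k, m, n; auto.
Qed.

(** The code is the product of the moduli of those [u < k] that satisfy [P], built up over [u < j].
    Each modulus is at most [m * k + one], so the powers of that number bound the partial products;
    coprimality of the moduli excludes unwanted elements. *)
Lemma finite_set_code (P : N -> Prop) (k : N) : D0_1 P ->
  exists t, forall u, inset u t <-> u < k /\ P u.
Proof.
intros HP.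
destruct (common_multiple k) as (m & Hm0 & Hm).
destruct (power_table (m * k + one) k) as (E & M & HE & HM & E0 & ES & Etot).
pose (dvd u n := exists q, q < n + one /\ n = (m * (u + one) + one) * q).
assert (Hdvd : forall u n, (exists q, n = (m * (u + one) + one) * q) <-> dvd u n).
{ intros u n; split; intros (q & Hq); [|exists q; tauto].
  exists q; split; auto; rewrite Hq, (PM_mulC PM); apply le_mul_r, succ_neq0. }
assert (H : forall j, j < k + one -> forall e, e < M -> E j e ->
  exists n, n < e + one /\ (n <> zero /\
    forall u, u < k -> (dvd u n <-> P u /\ u < j))).
{ by_induction.
  - unfold dvd; d0.
  - intros _ e _ He; rewrite (E0 _ He); exists one; split; [apply lt_succ|].
    split; [apply one_neq0|].
    (* As [m] is nonzero, every modulus exceeds 1; hence 1 codes the empty set. *)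
    intros u Hu; split.
    + intros (q & _ & Hq); exfalso.
      destruct (zero_or_succ q) as [-> | [q' ->]].
      * apply one_neq0; rewrite Hq; ring.
      * destruct (zero_or_succ m) as [-> | [m' ->]]; [contradiction|].
        apply (@succ_neq0 (m' * (u + one) + u + (m' * (u + one) + u + one) * q' + q')).
        apply (@add_cancel _ _ one); rewrite add0l.
        etransitivity; [|symmetry; exact Hq]; ring.
    + intros [_ L]; now apply not_lt0 in L.
  - intros j IH Hj e _ He; apply ES in He as (e' & He' & ->).
    destruct (IH (lt_trans (lt_succ j) Hj) e' (HM _ _ He') He') as (n & Hn & Hn0 & Hd).
    assert (Hjk : j < k).
    { destruct (lt_total j k) as [L | [-> | L]]; auto.
      - now apply lt_irrefl in Hj.
      - apply lt_succ_mono in L; destruct (lt_irrefl (lt_trans L Hj)). }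
    destruct (classic (P j)) as [Pj | Pj].
    + exists (n * (m * (j + one) + one)); split.
      { apply le_mul2; auto; apply lt_succ_mono.
        rewrite (PM_mulC PM m), (PM_mulC PM m); apply le_mul2; [|apply lt_succ].
        now apply lt_succ_mono. }
      split; [apply mul_neq0; auto; apply succ_neq0|].
      intros u Hu; rewrite <- Hdvd; split.
      * intros (q & Hq); destruct (classic (u = j)) as [-> | Huj].
        { split; auto; apply lt_succ. }
        destruct (dvd_cancel_modulus Hm Hu Hjk Huj Hq) as (q' & Hq').
        destruct (proj1 (Hd u Hu)) as [Pu L]; [apply Hdvd; eauto|].
        split; auto; now apply lt_S.
      * intros [Pu L]; apply le_cases in L as [L | ->].
        { destruct (proj2 (Hd u Hu) (conj Pu L)) as (q & _ & Hq).
          exists (q * (m * (j + one) + one)); rewrite Hq at 1; ring. }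
        { exists n; ring. }
    + exists n; split; [apply (le_trans Hn), le_mul_r, succ_neq0|].
      split; auto; intros u Hu; rewrite (Hd u Hu); split; intros [Pu L]; split; auto.
      * now apply lt_S.
      * apply le_cases in L as [L | ->]; auto; contradiction. }
destruct (Etot k (lt_succ k)) as [e He].
destruct (H k (lt_succ k) e (HM _ _ He) He) as (n & _ & _ & Hd).
exists ⟨k, ⟨m, n⟩⟩; intros u; rewrite inset_code, Hdvd.
split; intros [Hu K]; split; auto; [now apply (Hd u Hu) | now apply (Hd u Hu)].
Qed.

(** * Bounding for Sigma1 formulas *)

Lemma Delta1_set (R Q : N -> N -> Prop) : D0_2 R -> D0_2 Q ->
  (forall x, (exists z, R z x) <-> (forall z, Q z x)) ->
  exists X, isset X /\ forall x, X x <-> exists z, R z x.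
Proof.
intros HR HQ H; apply (F_Delta1_CA HF); [now apply definable_Sigma1|].
destruct (definable_Pi1 HQ) as (phi & rho & sigma & H1 & H2 & H3).
exists phi, rho, sigma; split; [auto | split; [auto|]]; intros x; now rewrite H.
Qed.

Lemma Delta0_set (S : N -> Prop) : D0_1 S -> exists X, isset X /\ forall x, X x <-> S x.
Proof.
intros HS; destruct (@Delta1_set (fun _ x => S x) (fun _ x => S x)) as (X & HX & H).
- unfold D0_2; d0.
- unfold D0_2; d0.
- intros x; split; [intros [_ Hx]; auto | intros Hx; exists zero; exact (Hx zero)].
- exists X; split; auto; intros x; rewrite H; split; [intros [_ Hx]; auto|].
  intros Hx; now exists zero.
Qed.

Lemma preorder_max (Le : N -> N -> Prop) (n : N) : D0_2 Le ->
  (forall i j, i < n -> j < n -> Le i j \/ Le j i) ->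
  (forall i j k, i < n -> j < n -> k < n -> Le i j -> Le j k -> Le i k) ->
  n <> zero -> exists j, j < n /\ forall i, i < n -> Le i j.
Proof.
intros HL Htot Htr Hn.
destruct (zero_or_succ n) as [-> | [m ->]]; [contradiction|].
assert (H : forall k, k < m + one -> exists j, j < k + one /\ forall i, i < k + one -> Le i j).
{ by_induction.
  - d0.
  - intros H0; exists zero; split; [apply lt_succ|].
    intros i Hi; apply le_cases in Hi as [Hi | ->]; [now apply not_lt0 in Hi|].
    destruct (Htot zero zero H0 H0); auto.
  - intros k IH Hk; destruct (IH (lt_trans (lt_succ k) Hk)) as (j & Hj & Hmax).
    assert (Hjm : j < m + one) by exact (lt_trans Hj Hk).
    destruct (Htot j (k + one) Hjm Hk) as [L | L].
    + exists (k + one); split; [apply lt_succ|].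
      intros i Hi; apply le_cases in Hi as [Hi | ->].
      * apply Htr with j; auto; exact (lt_trans Hi Hk).
      * destruct (Htot (k + one) (k + one) Hk Hk); auto.
    + exists j; split; [now apply lt_S|].
      intros i Hi; apply le_cases in Hi as [Hi | ->]; auto. }
exact (H m (lt_succ m)).
Qed.

(* Comparing the least witnesses g(i) preorders the numbers below n.  The
   preorder is Delta1, hence a set, so it has a maximum by Delta0 induction;
   the witness of the maximum is the bound. *)
Lemma Sigma1_bounding (R : N -> N -> Prop) (n : N) : D0_2 R ->
  (forall i, i < n -> exists b, R b i) ->
  exists B, forall i, i < n -> exists b, b < B /\ R b i.
Proof.
intros HR H.
assert (Hleast : forall i, i < n -> exists b, R b i /\ forall c, c < b -> ~ R c i).
{ intros i Hi; destruct (H i Hi) as (b & Hb).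
  apply (D0_least (S := fun b => R b i)) with b; auto; unfold D0_1; d0. }
(* Two forms of g(i) <= g(j): some witness for [i] has no witness for [j] below it; every witness
   for [j] has a witness for [i] at or below it. Both contain the clause that [x] is a pair of
   numbers below [n], so that they agree on every [x]. *)
destruct (@Delta1_set
  (fun b x => exists i j, x = ⟨i, j⟩ /\
     (i < n /\ j < n /\ R b i /\ forall c, c < b -> ~ R c j))
  (fun b x => exists i j, x = ⟨i, j⟩ /\
     (i < n /\ j < n /\ (R b j -> exists c, c < b + one /\ R c i))))
  as (X & HX & HXe).
- unfold D0_2; d0.
- unfold D0_2; d0.
- intros x; split.
  + intros (b & i & j & -> & Hi & Hj & Hb & Hm) b'; exists i, j; repeat split; auto.
    intros Hb'; exists b; split; auto.
    destruct (lt_total b b') as [L | [-> | L]]; [now apply lt_S | apply lt_succ|].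
    now apply Hm in Hb'.
  + intros K; destruct (K zero) as (i & j & -> & Hi & Hj & _).
    destruct (Hleast j Hj) as (b & Hb & Hm).
    destruct (K b) as (i' & j' & E & _ & _ & Hc).
    apply pair_inj in E as [<- <-].
    destruct (Hc Hb) as (c & Hcb & Rc).
    exists c, i, j; repeat split; auto.
    intros d Hd; apply Hm; exact (lt_le_trans Hd Hcb).
- assert (HLe : forall i j, i < n -> j < n -> (X ⟨i, j⟩ <->
    exists b, R b i /\ forall c, c < b -> ~ R c j)).
  { intros i j Hi Hj; rewrite HXe; split.
    - intros (b & i' & j' & E & _ & _ & K); apply pair_inj in E as [-> ->]; eauto.
    - intros (b & K); exists b, i, j; repeat split; tauto. }
  assert (Hmin : forall i b c, R b i -> (forall d, d < c -> ~ R d i) -> c < b + one).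
  { intros i b c Rb Hc; apply not_lt_le; intros L; exact (Hc b L Rb). }
  destruct (classic (n = zero)) as [-> | Hn].
  { exists zero; intros i Hi; now apply not_lt0 in Hi. }
  destruct (@preorder_max (fun i j => X ⟨i, j⟩) n) as (j & Hj & Hmax); auto.
  + unfold D0_2; d0.
  + intros i j Hi Hj; rewrite !HLe by auto.
    destruct (Hleast i Hi) as (b & Rb & Hb), (Hleast j Hj) as (c & Rc & Hc).
    destruct (classic (b < c)) as [L | L].
    * left; exists b; split; auto; intros d Hd; apply Hc; exact (lt_trans Hd L).
    * right; exists c; split; auto; intros d Hd; apply Hb.
      exact (lt_le_trans Hd (not_lt_le L)).
  + intros i j k Hi Hj Hk; rewrite !HLe by auto.
    intros (b & Rb & Hb) (c & Rc & Hc); exists b; split; auto.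
    intros d Hd; apply Hc; apply (lt_le_trans Hd); now apply (@Hmin j).
  + destruct (Hleast j Hj) as (b & Rb & Hb).
    exists (b + one); intros i Hi.
    specialize (Hmax i Hi); apply HLe in Hmax as (c & Rc & Hc); auto.
    exists c; split; auto; now apply (@Hmin j).
Qed.

(** * Computations *)

Lemma num_inj n : forall m, @num N n = num m -> n = m.
Proof.
induction n as [|n IH]; intros [|m] H; simpl in H; auto.
- symmetry in H; now apply succ_neq0 in H.
- now apply succ_neq0 in H.
- apply add_cancel in H; f_equal; auto.
Qed.

(** The inductive rules as a disjunction of equations and unpacked pairs, a shape that the
    definability tactic can traverse. *)
Definition step (A : N -> Prop) (G : N -> N -> N -> Prop) (c x y : N) : Prop :=
  c = ⟨num 0, y⟩ \/
  (c = ⟨num 1, zero⟩ /\ y = x) \/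
  (c = ⟨num 2, zero⟩ /\ exists u v, x = ⟨u, v⟩ /\ y = u) \/
  (c = ⟨num 3, zero⟩ /\ exists u v, x = ⟨u, v⟩ /\ y = v) \/
  (c = ⟨num 4, zero⟩ /\ exists u v, x = ⟨u, v⟩ /\ y = u + v) \/
  (c = ⟨num 5, zero⟩ /\ exists u v, x = ⟨u, v⟩ /\ y = u * v) \/
  (c = ⟨num 6, zero⟩ /\ exists u v, x = ⟨u, v⟩ /\
     ((u < v /\ y = zero) \/ (~ u < v /\ y = one))) \/
  (c = ⟨num 7, zero⟩ /\ ((A x /\ y = zero) \/ (~ A x /\ y = one))) \/
  (exists a e, c = ⟨a, e⟩ /\ (a = num 8 /\
     exists c d, e = ⟨c, d⟩ /\ exists u v, y = ⟨u, v⟩ /\ (G c x u /\ G d x v))) \/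
  (exists a e, c = ⟨a, e⟩ /\ (a = num 9 /\
     exists c d, e = ⟨c, d⟩ /\ exists u, G d x u /\ G c u y)) \/
  (exists a c', c = ⟨a, c'⟩ /\ (a = num 10 /\ (G c' ⟨x, y⟩ zero /\
     forall z, z < y -> exists v, v <> zero /\ G c' ⟨x, z⟩ v))).

Lemma justified_step A G c x y : justified A G c x y <-> step A G c x y.
Proof.
split.
- unfold step; intros []; [tauto | tauto | | | | | | | tauto | tauto | | | ].
  + right; right; left; eauto.
  + do 3 right; left; eauto.
  + do 4 right; left; eauto.
  + do 5 right; left; eauto.
  + do 6 right; left; split; auto; exists u, v; tauto.
  + do 6 right; left; split; auto; exists u, v; tauto.
  + do 8 right; left; exists (num 8), ⟨c0, d⟩; repeat split; exists c0, d; repeat split; eauto 10.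
  + do 9 right; left; exists (num 9), ⟨c0, d⟩; repeat split; exists c0, d; repeat split; eauto.
  + do 10 right; exists (num 10), c0; auto.
- unfold step; intros [-> | [[-> ->] | [(-> & u & v & -> & ->) | [(-> & u & v & -> & ->)
    | [(-> & u & v & -> & ->) | [(-> & u & v & -> & ->)
    | [(-> & u & v & -> & [[L ->] | [L ->]]) | [(-> & [[L ->] | [L ->]])
    | [(a & e & -> & -> & c0 & d & -> & u & v & -> & K1 & K2)
    | [(a & e & -> & -> & c0 & d & -> & u & K1 & K2)
    | (a & c0 & -> & -> & K1 & K2)]]]]]]]]]]; econstructor; eauto.
Qed.

(** Premises occur only positively, so equations may be added to a computation without spoiling
    earlier justifications. *)
Lemma justified_mono A (G G' : N -> N -> N -> Prop) c x y :
  (forall c x y, G c x y -> G' c x y) -> justified A G c x y -> justified A G' c x y.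
Proof.
intros H []; econstructor; eauto.
intros z Hz; match goal with K : forall z, z < _ -> _ |- _ => destruct (K z Hz) as (v & Hv & Kv) end.
eauto.
Qed.

Lemma D0_computation A f : isset A -> Tm f -> D0 (fun rho => computation A (f rho)).
Proof.
intros HA Hf; apply (@D0_rel1 (computation A)); auto; unfold D0_1, computation.
apply (D0_all (f := fun rho => rho 0)); [|tm|].
{ intros rho u H; apply NNPP; intros L; apply H; intros K.
  destruct (L (inset_bound K)). }
d0.
apply D0_ext with (fun rho => exists c p, rho 0 = ⟨c, p⟩ /\
  exists x y, p = ⟨x, y⟩ /\ step A (fun c' x' y' => inset ⟨c', ⟨x', y'⟩⟩ (rho 1)) c x y).
{ intros rho; split.
  - intros (c & p & E & x & y & -> & K); exists c, x, y; split; auto.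
    now apply justified_step.
  - intros (c & x & y & E & K); apply justified_step in K.
    exists c, ⟨x, y⟩; split; auto; exists x, y; auto. }
unfold step; d0.
(* Intermediate values, of a composition here and of a minimization below, are components of
   elements of the coded set. Its code, [rho 9] and [rho 8] under the binders opened so far,
   therefore bounds them. *)
- apply (D0_ex (f := fun rho => rho 9)); [|tm|d0].
  intros rho u [K _]; apply inset_bound in K.
  refine (le_lt_trans _ K); exact (le_trans (pair_le_r _ _) (le_trans (pair_le_r _ _) (lt_succ _))).
- apply (D0_ex (f := fun rho => rho 8)); [|tm|d0].
  intros rho u [_ K]; apply inset_bound in K.
  refine (le_lt_trans _ K); exact (le_trans (pair_le_r _ _) (pair_le_r _ _)).
Qed.

Ltac d0_atom ::= first
  [ apply D0_inset; [solve [tm]|solve [tm]]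
  | apply D0_computation; [assumption|solve [tm]] ].

(** * Computations relative to a fixed oracle *)

Section Oracle.
Variable A : N -> Prop.
Hypothesis HA : isset A.

(** The graph of the partial function with index [e]. Instead of a general uniqueness proof, each
    code constructed below comes with an equivalence that pins down its value. *)
Definition Comp (e x y : N) : Prop :=
  exists t, computation A t /\ inset ⟨e, ⟨x, y⟩⟩ t.

Definition Comp_below (b e x y : N) : Prop :=
  exists t, t < b /\ (computation A t /\ inset ⟨e, ⟨x, y⟩⟩ t).

Lemma W_Comp e x : W A e x <-> exists y, Comp e x y.
Proof.
split.
- intros (s & t & _ & K & y & Hy); exists y, t; auto.
- intros (y & t & K & Hy); exists (t + one), t; split; [apply lt_succ|].
  split; eauto.
Qed.

(** Being an element of some computation below [b] is Delta0, so the union of these computations has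
    a code, and by monotonicity it is a computation. *)
Lemma Comp_collect b : exists T, computation A T /\
  forall e x y, Comp_below b e x y -> inset ⟨e, ⟨x, y⟩⟩ T.
Proof.
destruct (@finite_set_code (fun u => exists t, t < b /\ (computation A t /\ inset u t)) b) as (T & HT).
{ unfold D0_1; d0. }
exists T; split.
- intros u Hu; apply HT in Hu as (_ & t & Ht & K & Hu).
  destruct (K u Hu) as (c & x & y & -> & J); exists c, x, y; split; auto.
  refine (justified_mono _ J); intros c' x' y' I; apply HT.
  split; [exact (lt_trans (inset_bound I) Ht) | eauto].
- intros e x y (t & Ht & K & I); apply HT.
  split; [exact (lt_trans (inset_bound I) Ht) | eauto].
Qed.

(** Only minimization has possibly nonstandardly many premises; Sigma1 bounding finds a common bound
    for their computations. *)
Lemma Comp_below_step e x y : justified A Comp e x y ->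
  exists b, justified A (Comp_below b) e x y.
Proof.
intros []; try (exists zero; constructor; now auto).
- destruct H as (t & Ht), H0 as (t' & Ht').
  exists (t + t' + one); constructor.
  + exists t; split; auto; apply lt_ex; exists t'; ring.
  + exists t'; split; auto; apply lt_ex; exists t; ring.
- destruct H as (t & Ht), H0 as (t' & Ht').
  exists (t + t' + one); apply J_comp with u.
  + exists t; split; auto; apply lt_ex; exists t'; ring.
  + exists t'; split; auto; apply lt_ex; exists t; ring.
- destruct H as (t & Ht).
  destruct (@Sigma1_bounding (fun t z => computation A t /\
    exists v, v < t /\ (v <> zero /\ inset ⟨c, ⟨⟨x0, z⟩, v⟩⟩ t)) y0) as (B & HB).
  { unfold D0_2; d0. }
  { intros z Hz; destruct (H0 z Hz) as (v & Hv & s & Hs & I).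
    exists s; split; auto; exists v; split; auto.
    refine (le_lt_trans _ (inset_bound I)).
    exact (le_trans (pair_le_r _ _) (pair_le_r _ _)). }
  exists (t + B + one); constructor.
  + exists t; split; auto; apply lt_ex; exists B; ring.
  + intros z Hz; destruct (HB z Hz) as (s & Hs & Cs & v & _ & Hv & I).
    exists v; split; auto; exists s; split; auto.
    apply (lt_trans Hs); apply lt_ex; exists t; ring.
Qed.

(** [Comp] is a fixed point of the rules. From right to left, the premises are collected into one
    computation and the new equation is added to it. *)
Lemma Comp_step e x y : Comp e x y <-> step A Comp e x y.
Proof.
rewrite <- justified_step; split.
- intros (t & Ht & I); destruct (Ht _ I) as (c & x' & y' & E & J).
  apply pair_inj in E as [-> E]; apply pair_inj in E as [-> ->].
  refine (justified_mono _ J); intros c1 x1 y1 I1; exists t; auto.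
- intros J; apply Comp_below_step in J as (b & J).
  destruct (Comp_collect b) as (T & CT & HT).
  destruct (@finite_set_code (fun u => inset u T \/ u = ⟨e, ⟨x, y⟩⟩) (T + ⟨e, ⟨x, y⟩⟩ + one)) as (T' & HT').
  { unfold D0_1; d0. }
  assert (Hsub : forall u, inset u T -> inset u T').
  { intros u Hu; apply HT'; split; auto.
    apply (lt_trans (inset_bound Hu)); apply lt_ex; exists ⟨e, ⟨x, y⟩⟩; ring. }
  exists T'; split.
  + intros u Hu; apply HT' in Hu as (_ & [Hu | ->]).
    * destruct (CT u Hu) as (c1 & x1 & y1 & -> & J1); exists c1, x1, y1; split; auto.
      refine (justified_mono _ J1); auto.
    * exists e, x, y; split; auto.
      refine (justified_mono _ J); auto.
  + apply HT'; split; auto; apply lt_ex; exists T; ring.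
Qed.

(** The clauses are selected by an external natural number, so that evaluation picks the rule once
    the tag of an index is known. *)
Definition tagged_step (k : nat) (d x y : N) : Prop :=
  match k with
  | 0 => y = d
  | 1 => d = zero /\ y = x
  | 2 => d = zero /\ exists u v, x = ⟨u, v⟩ /\ y = u
  | 3 => d = zero /\ exists u v, x = ⟨u, v⟩ /\ y = v
  | 4 => d = zero /\ exists u v, x = ⟨u, v⟩ /\ y = u + v
  | 5 => d = zero /\ exists u v, x = ⟨u, v⟩ /\ y = u * v
  | 6 => d = zero /\ exists u v, x = ⟨u, v⟩ /\
           ((u < v /\ y = zero) \/ (~ u < v /\ y = one))
  | 7 => d = zero /\ ((A x /\ y = zero) \/ (~ A x /\ y = one))
  | 8 => exists c c', d = ⟨c, c'⟩ /\ exists u v, y = ⟨u, v⟩ /\ (Comp c x u /\ Comp c' x v)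
  | 9 => exists c c', d = ⟨c, c'⟩ /\ exists u, Comp c' x u /\ Comp c u y
  | 10 => Comp d ⟨x, y⟩ zero /\ forall z, z < y -> exists v, v <> zero /\ Comp d ⟨x, z⟩ v
  | _ => False
  end.

Lemma Comp_tag k d x y : Comp ⟨num k, d⟩ x y <-> tagged_step k d x y.
Proof.
rewrite Comp_step; split.
- unfold step; intros [E | [[E H] | [[E H] | [[E H] | [[E H] | [[E H] | [[E H] | [[E H]
    | [(a & d' & E & -> & H) | [(a & d' & E & -> & H) | (a & d' & E & -> & H)]]]]]]]]]];
    apply pair_inj in E as [E ->]; apply num_inj in E as ->; cbn; auto.
- rewrite <- justified_step; destruct k as [|[|[|[|[|[|[|[|[|[|[|k]]]]]]]]]]]; cbn [tagged_step].
  + intros ->; constructor.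
  + intros [-> ->]; constructor.
  + intros (-> & u & v & -> & ->); constructor.
  + intros (-> & u & v & -> & ->); constructor.
  + intros (-> & u & v & -> & ->); constructor.
  + intros (-> & u & v & -> & ->); constructor.
  + intros (-> & u & v & -> & [[L ->] | [L ->]]); now constructor.
  + intros (-> & [[L ->] | [L ->]]); now constructor.
  + intros (c & c' & -> & u & v & -> & K1 & K2); now constructor.
  + intros (c & c' & -> & u & K1 & K2); now apply J_comp with u.
  + intros [K1 K2]; now constructor.
  + intros [].
Qed.

(** * Codes for Delta0 formulas *)

(** Nested to the left with variable 0 outermost: adding a variable [z] to the input [x] yields ⟨x,
    z⟩, exactly the argument on which minimization calls its body. *)
Fixpoint enc (n : nat) (v : nat -> N) : N :=
  match n with
  | O => zero
  | S n => ⟨enc n (fun i => v (S i)), v O⟩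
  end.

(* [f] is computed from the first [n] variables, the others being fixed
   parameters. *)
Definition coded (n : nat) (p : nat -> N) (f : (nat -> N) -> N) : Prop :=
  exists e, forall v, (forall i, v (n + i)%nat = p i) ->
    forall y, Comp e (enc n v) y <-> y = f v.

Definition chi (P : Prop) : N := if excluded_middle_informative P then zero else one.

Lemma chi_true (P : Prop) : P -> chi P = zero.
Proof. unfold chi; destruct (excluded_middle_informative P); tauto. Qed.

Lemma chi_false (P : Prop) : ~ P -> chi P = one.
Proof. unfold chi; destruct (excluded_middle_informative P); tauto. Qed.

Lemma chi_eq (P : Prop) y : ((P /\ y = zero) \/ (~ P /\ y = one)) <-> y = chi P.
Proof.
destruct (classic P); [rewrite chi_true by auto | rewrite chi_false by auto]; tauto.
Qed.

Lemma chi_iff (P Q : Prop) : (P <-> Q) -> chi P = chi Q.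
Proof. intros H; apply chi_eq; rewrite <- H; now apply chi_eq. Qed.

Lemma chi_zero (P : Prop) : chi P = zero <-> P.
Proof.
split; [|apply chi_true].
intros H; apply NNPP; intros K; rewrite (chi_false K) in H; now apply one_neq0 in H.
Qed.

Lemma coded_ext n p f g : (forall v, f v = g v) -> coded n p f -> coded n p g.
Proof.
intros H (e & He); exists e; intros v Hv y; now rewrite <- H, (He v Hv).
Qed.

Lemma coded_const n p c : coded n p (fun _ => c).
Proof. exists ⟨num 0, c⟩; intros v _ y; apply Comp_tag. Qed.

Lemma coded_comp n p f d (F : N -> N) :
  (forall x y, Comp d x y <-> y = F x) -> coded n p f -> coded n p (fun v => F (f v)).
Proof.
intros Hd (e & He); exists ⟨num 9, ⟨d, e⟩⟩; intros v Hv y; rewrite Comp_tag; cbn [tagged_step]; split.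
- intros (c & c' & E & u & H1 & H2); apply pair_inj in E as [<- <-].
  apply (He v Hv) in H1 as ->; now apply Hd.
- intros ->; exists d, e; split; auto; exists (f v); now rewrite Hd, (He v Hv).
Qed.

Lemma coded_op n p f g d (F : N -> N -> N) :
  (forall u v y, Comp d ⟨u, v⟩ y <-> y = F u v) ->
  coded n p f -> coded n p g -> coded n p (fun v => F (f v) (g v)).
Proof.
intros Hd (e & He) (e' & He').
exists ⟨num 9, ⟨d, ⟨num 8, ⟨e, e'⟩⟩⟩⟩; intros v Hv y; rewrite Comp_tag; cbn [tagged_step]; split.
- intros (c & c' & E & u & H1 & H2); apply pair_inj in E as [<- <-].
  apply Comp_tag in H1 as (c & c' & E & u1 & u2 & -> & K1 & K2).
  apply pair_inj in E as [<- <-].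
  apply (He v Hv) in K1 as ->; apply (He' v Hv) in K2 as ->; now apply Hd.
- intros ->; exists d, ⟨num 8, ⟨e, e'⟩⟩; split; auto; exists ⟨f v, g v⟩; rewrite Hd.
  split; auto; apply Comp_tag; exists e, e'; split; auto; exists (f v), (g v).
  rewrite (He v Hv), (He' v Hv); auto.
Qed.

Lemma Comp_add u v y : Comp ⟨num 4, zero⟩ ⟨u, v⟩ y <-> y = u + v.
Proof.
rewrite Comp_tag; cbn [tagged_step]; split; [|eauto].
intros (_ & u' & v' & E & ->); now apply pair_inj in E as [<- <-].
Qed.

Lemma Comp_mul u v y : Comp ⟨num 5, zero⟩ ⟨u, v⟩ y <-> y = u * v.
Proof.
rewrite Comp_tag; cbn [tagged_step]; split; [|eauto].
intros (_ & u' & v' & E & ->); now apply pair_inj in E as [<- <-].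
Qed.

Lemma Comp_lt u v y : Comp ⟨num 6, zero⟩ ⟨u, v⟩ y <-> y = chi (u < v).
Proof.
rewrite <- chi_eq, Comp_tag; cbn [tagged_step]; split; [|eauto].
intros (_ & u' & v' & E & K); now apply pair_inj in E as [<- <-].
Qed.

Lemma Comp_fst u v y : Comp ⟨num 2, zero⟩ ⟨u, v⟩ y <-> y = u.
Proof.
rewrite Comp_tag; cbn [tagged_step]; split; [|eauto].
intros (_ & u' & v' & E & ->); now apply pair_inj in E as [<- <-].
Qed.

Lemma Comp_snd u v y : Comp ⟨num 3, zero⟩ ⟨u, v⟩ y <-> y = v.
Proof.
rewrite Comp_tag; cbn [tagged_step]; split; [|eauto].
intros (_ & u' & v' & E & ->); now apply pair_inj in E as [<- <-].
Qed.

Lemma coded_shift n p f : coded n p f -> coded (S n) p (fun v => f (fun i => v (S i))).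
Proof.
intros (e & He); exists ⟨num 9, ⟨e, ⟨num 2, zero⟩⟩⟩; intros v Hv y.
specialize (He (fun i => v (S i)) Hv); rewrite Comp_tag; cbn [tagged_step enc]; split.
- intros (c & c' & E & u & H1 & H2); apply pair_inj in E as [<- <-].
  apply Comp_fst in H1 as ->; now apply He.
- intros ->; exists e, ⟨num 2, zero⟩; split; auto; eexists; rewrite Comp_fst.
  split; [reflexivity | now apply He].
Qed.

Lemma coded_var i : forall n p, coded n p (fun v => v i).
Proof.
induction i as [|i IH]; intros [|n] p.
- exists ⟨num 0, p O⟩; intros v Hv y; rewrite Comp_tag; cbn [tagged_step]; rewrite <- Hv; reflexivity.
- exists ⟨num 3, zero⟩; intros v Hv y; apply Comp_snd.
- exists ⟨num 0, p (S i)⟩; intros v Hv y; rewrite Comp_tag; cbn [tagged_step]; rewrite <- Hv; reflexivity.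
- apply (coded_shift (IH n p)).
Qed.

Lemma coded_term t n p : coded n p (fun v => eval v t).
Proof.
induction t; cbn.
- apply coded_var.
- apply coded_const.
- apply coded_const.
- exact (coded_op Comp_add IHt1 IHt2).
- exact (coded_op Comp_mul IHt1 IHt2).
Qed.

Lemma coded_lt n p f g : coded n p f -> coded n p g ->
  coded n p (fun v => chi (f v < g v)).
Proof. exact (coded_op Comp_lt). Qed.

(** The connectives are reduced to comparisons and sums of the truth values 0 and 1. *)
Lemma coded_not n p (P : (nat -> N) -> Prop) :
  coded n p (fun v => chi (P v)) -> coded n p (fun v => chi (~ P v)).
Proof.
intros H; apply coded_ext with (fun v => chi (zero < chi (P v))).
- intros v; apply chi_iff; destruct (classic (P v)) as [K | K].
  + rewrite (chi_true K); split; [intros L; now apply lt_irrefl in L | tauto].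
  + rewrite (chi_false K); split; auto; intros _; apply (PM_lt01 PM).
- apply coded_lt; auto; apply coded_const.
Qed.

Lemma coded_and n p (P Q : (nat -> N) -> Prop) :
  coded n p (fun v => chi (P v)) -> coded n p (fun v => chi (Q v)) ->
  coded n p (fun v => chi (P v /\ Q v)).
Proof.
intros HP HQ; apply coded_ext with (fun v => chi (chi (P v) + chi (Q v) < one)).
- intros v; apply chi_iff; split.
  + intros H; replace (one : N) with (zero + one : N) in H by ring.
    apply le_cases in H as [H | H]; [now apply not_lt0 in H|].
    rewrite <- (chi_zero (P v)), <- (chi_zero (Q v)).
    split; [apply (@add_eq0_r (chi (Q v))); now rewrite (PM_addC PM) | now apply add_eq0_r in H].
  + intros [K1 K2]; rewrite (chi_true K1), (chi_true K2), add0l; apply (PM_lt01 PM).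
- apply coded_lt; [now apply (coded_op Comp_add) | apply coded_const].
Qed.

Lemma coded_or n p (P Q : (nat -> N) -> Prop) :
  coded n p (fun v => chi (P v)) -> coded n p (fun v => chi (Q v)) ->
  coded n p (fun v => chi (P v \/ Q v)).
Proof.
intros HP HQ; apply coded_ext with (fun v => chi (~ (~ P v /\ ~ Q v))).
- intros v; apply chi_iff; destruct (classic (P v)); tauto.
- now apply coded_not, coded_and; apply coded_not.
Qed.

Lemma Comp_mu c x (P : N -> Prop) : D0_1 P -> (exists z, P z) ->
  (forall z y, Comp c ⟨x, z⟩ y <-> y = chi (P z)) ->
  forall y, Comp ⟨num 10, c⟩ x y <-> P y /\ forall z, z < y -> ~ P z.
Proof.
intros HP Hex Hc y; rewrite Comp_tag; cbn [tagged_step]; rewrite Hc; split.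
- intros [E K]; symmetry in E; apply (proj1 (chi_zero _)) in E; split; auto.
  intros z Hz Pz; destruct (K z Hz) as (v & Hv & E'); apply Hc in E'.
  now rewrite (chi_true Pz) in E'.
- intros [Py K]; split; [symmetry; now apply chi_true|].
  intros z Hz; exists one; split; [apply one_neq0|].
  apply Hc; symmetry; apply chi_false; auto.
Qed.

(** Search for the least [z] that satisfies [P] or is not below the bound. The search halts, at the
    latest at the bound, and a witness exists iff its result is below the bound. *)
Lemma coded_bex n p f (P : (nat -> N) -> Prop) :
  coded n p f -> coded (S n) p (fun v => chi (P v)) ->
  (forall v, D0_1 (fun x => P (scons x v))) ->
  coded n p (fun v => chi (exists x, x < f v /\ P (scons x v))).
Proof.
intros Hf HP HD.
assert (HC : coded (S n) p (fun v => chi (~ v O < f (fun i => v (S i)) \/ P v))).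
{ apply coded_or; auto; apply coded_not, coded_lt; [apply coded_var | now apply coded_shift]. }
destruct HC as (c & Hc), Hf as (e & He).
exists ⟨num 9, ⟨⟨num 6, zero⟩, ⟨num 8, ⟨⟨num 10, c⟩, e⟩⟩⟩⟩; intros v Hv y.
pose (S z := ~ z < f v \/ P (scons z v)).
assert (HS : D0_1 S).
{ unfold D0_1, S; apply D0_or; [d0 | apply HD]. }
assert (Hex : exists z, S z) by (exists (f v); left; apply lt_irrefl).
assert (Hcv : forall z y, Comp c ⟨enc n v, z⟩ y <-> y = chi (S z)).
{ intros z; apply (Hc (scons z v) Hv). }
assert (Hmu := Comp_mu HS Hex Hcv).
destruct Hex as (z0 & Hz0); destruct (D0_least HS Hz0) as (m & Sm & Hm).
assert (Hres : (exists x, x < f v /\ P (scons x v)) <-> m < f v).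
{ split.
  - intros (x & Hx & Px); apply (le_lt_trans (y := x)); auto.
    apply not_lt_le; intros L; apply (Hm x L); now right.
  - intros L; exists m; split; auto; destruct Sm; tauto. }
rewrite (chi_iff Hres), Comp_tag; cbn [tagged_step]; split.
- intros (a & b & E & u & H1 & H2); apply pair_inj in E as [<- <-].
  apply Comp_tag in H1 as (a & b & E & z & w & -> & K1 & K2).
  apply pair_inj in E as [<- <-]; apply Hmu in K1 as [Sz Hz]; apply (He v Hv) in K2 as ->.
  apply Comp_lt in H2.
  replace m with z; auto.
  destruct (lt_total z m) as [L | [L | L]]; auto; exfalso; [exact (Hm z L Sz) | exact (Hz m L Sm)].
- intros ->; eexists; eexists; split; [reflexivity|]; exists ⟨m, f v⟩; rewrite Comp_lt.
  split; auto; apply Comp_tag; eexists; eexists; split; [reflexivity|].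
  exists m, (f v); split; auto; rewrite Hmu, (He v Hv); auto.
Qed.

Lemma D0_1_holds phi (v : nat -> N) sigma :
  Delta0 phi -> (forall j, isset (sigma j)) ->
  D0_1 (fun x => holds (scons x v) sigma phi).
Proof.
intros H1 H2; exists phi, (fun i => match i with O => inl O | S i => inr (v i) end), sigma.
split; [auto | split; [auto|]]; intros rho; apply holds_ext; intros [|i]; reflexivity.
Qed.

Fixpoint set_bound (phi : formula) : nat :=
  match phi with
  | FEq _ _ | FLt _ _ => 0
  | FMem _ X => S X
  | FNot phi | FBAll _ phi | FBEx _ phi | FAll phi | FEx phi => set_bound phi
  | FAnd phi psi | FOr phi psi | FImp phi psi => max (set_bound phi) (set_bound psi)
  end.

(** External induction on the formula, for all [n] and [p] because a bounded quantifier adds an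
    input variable. Membership in set parameter [X] becomes an oracle query about column [X]. *)
Lemma coded_holds (sigma : nat -> N -> Prop) M :
  (forall j, isset (sigma j)) ->
  (forall X, (X < M)%nat -> forall u, A ⟨num X, u⟩ <-> sigma X u) ->
  forall phi, Delta0 phi -> (set_bound phi <= M)%nat ->
  forall n p, coded n p (fun v => chi (holds v sigma phi)).
Proof.
intros Hsig HM; induction phi; cbn; intros HD Hb n p; try contradiction.
- apply coded_ext with (fun v => chi (~ eval v s < eval v t /\ ~ eval v t < eval v s)).
  + intros v; apply chi_iff; split.
    * intros [K1 K2]; destruct (lt_total (eval v s) (eval v t)) as [L | [L | L]]; tauto.
    * intros ->; split; apply lt_irrefl.
  + apply coded_and; apply coded_not, coded_lt; apply coded_term.
- apply coded_lt; apply coded_term.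
- apply coded_ext with (fun v => chi (A ⟨num X, eval v t⟩)).
  + intros v; apply chi_iff, HM; exact Hb.
  + apply (@coded_comp n p (fun v => ⟨num X, eval v t⟩) ⟨num 7, zero⟩ (fun x => chi (A x))).
    * intros x y; rewrite Comp_tag, <- chi_eq; cbn [tagged_step]; tauto.
    * destruct (coded_term t n p) as (e & He).
      exists ⟨num 8, ⟨⟨num 0, num X⟩, e⟩⟩; intros v Hv y; rewrite Comp_tag; cbn [tagged_step]; split.
      { intros (c & c' & E & u & w & -> & K1 & K2); apply pair_inj in E as [<- <-].
        apply Comp_tag in K1 as ->; now apply (He v Hv) in K2 as ->. }
      { intros ->; eexists; eexists; split; [reflexivity|].
        exists (num X), (eval v t); split; auto; rewrite Comp_tag, (He v Hv); cbn; auto. }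
- apply coded_not; auto.
- apply coded_and; [apply IHphi1 | apply IHphi2]; intuition lia.
- apply coded_or; [apply IHphi1 | apply IHphi2]; intuition lia.
- apply coded_ext with (fun v => chi (~ holds v sigma phi1 \/ holds v sigma phi2)).
  + intros v; apply chi_iff; destruct (classic (holds v sigma phi1)); tauto.
  + apply coded_or; [apply coded_not, IHphi1 | apply IHphi2]; intuition lia.
- apply coded_ext with (fun v => chi (~ exists x, x < eval v t /\
    ~ holds (scons x v) sigma phi)).
  + intros v; apply chi_iff; split.
    * intros H x Hx; apply NNPP; intros K; eauto.
    * intros H (x & Hx & K); auto.
  + apply coded_not.
    apply (@coded_bex n p (fun v => eval v t) (fun v => ~ holds v sigma phi)).
    * apply coded_term.
    * apply coded_not; auto.
    * intros v; apply D0_not; now apply D0_1_holds.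
- apply (@coded_bex n p (fun v => eval v t) (fun v => holds v sigma phi)); auto.
  + apply coded_term.
  + intros v; now apply D0_1_holds.
Qed.

End Oracle.

(** * Uniform enumeration of Sigma1 relations *)

Lemma oracle_join (sigma : nat -> N -> Prop) M : (forall j, isset (sigma j)) ->
  exists A, isset A /\
    forall X, (X < M)%nat -> forall u, A ⟨num X, u⟩ <-> sigma X u.
Proof.
intros Hs; induction M as [|M (A & HA & IH)]; [exists X0; split; auto; lia|].
assert (HsM := Hs M).
(* The new oracle is the old one with column [M] overwritten by [sigma M]. *)
destruct (@Delta0_set (fun x =>
   (exists a u, x = ⟨a, u⟩ /\ (a = num M /\ sigma M u)) \/
   (~ (exists a u, x = ⟨a, u⟩ /\ a = num M) /\ A x))) as (B & HB & HBe).
{ unfold D0_1; d0. }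
exists B; split; auto; intros X HX u; rewrite HBe.
destruct (Nat.eq_dec X M) as [-> | HXM].
- split; [|left; eauto 6].
  intros [(a & w & E & -> & K) | [K _]].
  + now apply pair_inj in E as [_ ->].
  + exfalso; eauto.
- rewrite IH by lia; split.
  + intros [(a & w & E & -> & K) | [_ K]]; auto.
    apply pair_inj in E as [E _]; now apply num_inj in E.
  + intros K; right; split; auto; intros (a & w & E & ->).
    apply pair_inj in E as [E _]; now apply num_inj in E.
Qed.

(** [W] is a domain of convergence: on input [x], the index [g i] searches for a witness [z], and
    this halts iff there is one, as a Delta0 matrix has a least witness. *)
Lemma Sigma1_uniformly_ce (R : N -> N -> N -> Prop) : D0_3 R ->
  exists A g, isset A /\ computable g /\
    forall i x, W A (g i) x <-> exists z, R z x i.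
Proof.
intros HR; destruct (D0_formula HR) as (phi & rho & sigma & H1 & H2 & H3).
destruct (@oracle_join sigma (set_bound phi) H2) as (A & HA & HM).
destruct (coded_holds HA H2 HM H1 (le_n _) 3 rho) as (c & Hc).
(* An explicit s-m-n function: the constant ⟨zero, i⟩ is paired with the input before the search is
   run. Being a polynomial in [i], it has a Delta0 graph. *)
pose (g i := ⟨num 9, ⟨⟨num 10, c⟩, ⟨num 8, ⟨⟨num 0, ⟨zero, i⟩⟩, ⟨num 1, zero⟩⟩⟩⟩⟩).
exists A, g; split; [auto | split].
{ assert (Hg : D0_2 (fun i y => g i = y)) by (unfold D0_2, g; d0).
  split; apply (definable2_Delta0 (R := fun i y => g i = y)); auto;
    [exact Delta0_Sigma1 | exact Delta0_Pi1]. }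
intros i x; rewrite W_Comp.
assert (Hcz : forall z y, Comp A c ⟨⟨⟨zero, i⟩, x⟩, z⟩ y <-> y = chi (R z x i)).
{ intros z y; rewrite (Hc (scons z (scons x (scons i rho))) (fun _ => eq_refl)).
  now rewrite (chi_iff (H3 z x i)). }
assert (Hg : forall y, Comp A (g i) x y <-> Comp A ⟨num 10, c⟩ ⟨⟨zero, i⟩, x⟩ y).
{ intros y; unfold g; rewrite Comp_tag by auto; cbn [tagged_step]; split.
  - intros (a & b & E & u & K1 & K2); apply pair_inj in E as [<- <-].
    apply Comp_tag in K1 as (a & b & E & z & w & -> & L1 & L2); auto.
    apply pair_inj in E as [<- <-].
    apply Comp_tag in L1; auto; apply Comp_tag in L2; auto; cbn in L1, L2.
    now destruct L2 as [_ ->]; subst z.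
  - intros K; eexists; eexists; split; [reflexivity|]; eexists; split; [|exact K].
    apply Comp_tag; auto; eexists; eexists; split; [reflexivity|].
    eexists; eexists; split; [reflexivity|]; split; apply Comp_tag; cbn; auto. }
assert (HD : D0_1 (fun z => R z x i)) by (unfold D0_1; d0).
split.
- intros (y & Hy); apply Hg in Hy; apply Comp_tag in Hy as [Hy _]; auto.
  apply Hcz in Hy; exists y; now apply chi_zero.
- intros Hz; pose proof Hz as (z & Rz); destruct (D0_least HD Rz) as (y & Hy & Hm).
  exists y; apply Hg; apply (Comp_mu HA HD Hz Hcz); auto.
Qed.

(** * Normal forms *)

Lemma D0_holds phi (sigma : nat -> N -> Prop) :
  Delta0 phi -> (forall j, isset (sigma j)) -> D0 (fun rho => holds rho sigma phi).
Proof. intros H1 H2; exists phi, inl, sigma; repeat split; auto. Qed.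

(** Pairing contracts a block of existential quantifiers into a single one. *)
Lemma holds_Sigma1 phi (sigma : nat -> N -> Prop) :
  Sigma 1 phi -> (forall j, isset (sigma j)) -> exists Q : N -> (nat -> N) -> Prop,
  D0 (fun rho => Q (rho 0) (fun i => rho (S i))) /\
  forall rho, holds rho sigma phi <-> exists x, Q x rho.
Proof.
intros H Hs; remember 1 as m eqn:E; induction H as [phi H | n phi H | n phi H IH].
- discriminate.
- injection E as ->; inversion_clear H.
  exists (fun _ rho => holds rho sigma phi); split.
  + apply (@D0_env (fun rho => holds rho sigma phi) (fun i => inl (S i))
      (fun rho i => rho (S i))); [reflexivity | now apply D0_holds].
  + intros rho; split; [intros K; now exists zero | now intros [_ K]].
- destruct (IH E) as (Q & HQ & HQe).
  exists (fun b rho => exists x z, b = ⟨x, z⟩ /\ Q x (scons z rho)); split.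
  + d0.
    apply (@D0_env (fun rho => Q (rho 0) (fun i => rho (S i)))
      (fun i => inl (match i with 0 => 1 | 1 => 0 | S i => S (S i) end))
      (fun rho => scons (rho 1) (scons (rho 0) (fun i => rho (S (S (S i))))))); auto.
    intros rho [|[|i]]; reflexivity.
  + intros rho; simpl; split.
    * intros (z & K); apply HQe in K as (x & K); exists ⟨x, z⟩, x, z; auto.
    * intros (b & x & z & _ & K); exists z; apply HQe; eauto.
Qed.

Lemma holds_Pi1 phi (sigma : nat -> N -> Prop) :
  Pi 1 phi -> (forall j, isset (sigma j)) -> exists Q : N -> (nat -> N) -> Prop,
  D0 (fun rho => Q (rho 0) (fun i => rho (S i))) /\
  forall rho, holds rho sigma phi <-> forall x, Q x rho.
Proof.
intros H Hs; remember 1 as m eqn:E; induction H as [phi H | n phi H | n phi H IH].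
- discriminate.
- injection E as ->; inversion_clear H.
  exists (fun _ rho => holds rho sigma phi); split.
  + apply (@D0_env (fun rho => holds rho sigma phi) (fun i => inl (S i))
      (fun rho i => rho (S i))); [reflexivity | now apply D0_holds].
  + intros rho; split; [auto | intros K; exact (K zero)].
- destruct (IH E) as (Q & HQ & HQe).
  (* The pairing is not surjective: numbers that are no pairs have to satisfy the matrix, hence the
     negated existential. *)
  exists (fun b rho => ~ exists x z, b = ⟨x, z⟩ /\ ~ Q x (scons z rho)); split.
  + d0.
    apply (@D0_env (fun rho => Q (rho 0) (fun i => rho (S i)))
      (fun i => inl (match i with 0 => 1 | 1 => 0 | S i => S (S i) end))
      (fun rho => scons (rho 1) (scons (rho 0) (fun i => rho (S (S (S i))))))); auto.
    intros rho [|[|i]]; reflexivity.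
  + intros rho; simpl; split.
    * intros K b (x & z & _ & K'); apply K', HQe, K.
    * intros K z; apply HQe; intros x; apply NNPP; intros K'.
      apply (K ⟨x, z⟩); exists x, z; auto.
Qed.

Lemma holds_Sigma2 phi (sigma : nat -> N -> Prop) :
  Sigma 2 phi -> (forall j, isset (sigma j)) -> exists Q : N -> N -> (nat -> N) -> Prop,
  D0 (fun rho => Q (rho 0) (rho 1) (fun i => rho (S (S i)))) /\
  forall rho, holds rho sigma phi <-> exists z, forall w, Q w z rho.
Proof.
intros H Hs; remember 2 as m eqn:E; induction H as [phi H | n phi H | n phi H IH].
- discriminate.
- injection E as ->; destruct (holds_Pi1 H Hs) as (Q & HQ & HQe).
  exists (fun w _ rho => Q w rho); split.
  + apply (@D0_env (fun rho => Q (rho 0) (fun i => rho (S i)))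
      (fun i => inl (match i with 0 => 0 | S i => S (S i) end))
      (fun rho => scons (rho 0) (fun i => rho (S (S i))))); auto.
    intros rho [|i]; reflexivity.
  + intros rho; rewrite HQe; split; [intros K; now exists zero | now intros [_ K]].
- destruct (IH E) as (Q & HQ & HQe).
  exists (fun w d rho => exists x z, d = ⟨x, z⟩ /\ Q w x (scons z rho)); split.
  + d0.
    apply (@D0_env (fun rho => Q (rho 0) (rho 1) (fun i => rho (S (S i))))
      (fun i => inl (match i with 0 => 2 | 1 => 1 | 2 => 0 | S i => S (S i) end))
      (fun rho => scons (rho 2) (scons (rho 1) (scons (rho 0)
        (fun i => rho (S (S (S (S i))))))))); auto.
    intros rho [|[|[|i]]]; reflexivity.
  + intros rho; simpl; split.
    * intros (z & K); apply HQe in K as (x & K); exists ⟨x, z⟩; intros w; exists x, z; auto.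
    (* The instance at zero serves to decode [d]; by injectivity all other instances decode it in
       the same way. *)
    * intros (d & K); destruct (K zero) as (x & z & -> & _); exists z; apply HQe; exists x.
      intros w; destruct (K w) as (x' & z' & E' & K'); now apply pair_inj in E' as [<- <-].
Qed.

Lemma definable2_Sigma1_inv (R : N -> N -> Prop) : definable2 (Sigma 1) R ->
  exists Q, D0_3 Q /\ forall x y, R x y <-> exists z, Q z x y.
Proof.
intros (phi & rho & sigma & H1 & H2 & H3).
destruct (holds_Sigma1 H1 H2) as (Q & HQ & HQe).
exists (fun z x y => Q z (scons x (scons y rho))); split.
- apply (@D0_env (fun rho => Q (rho 0) (fun i => rho (S i)))
    (fun i => match i with S (S (S i)) => inr (rho i) | _ => inl i end)
    (fun r => scons (r 0) (scons (r 1) (scons (r 2) rho)))); auto.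
  intros r [|[|[|i]]]; reflexivity.
- intros x y; now rewrite H3.
Qed.

(** * The equivalences *)

Definition Pi1_bounding : Prop :=
  forall R, D0_3 R -> forall n,
    (forall i, i < n -> exists b, forall c, R c b i) ->
    exists B, forall i, i < n -> exists b, b < B /\ forall c, R c b i.

Lemma BSigma2_Pi1_bounding : BSigma 2 N -> Pi1_bounding.
Proof.
intros H R HR n; apply (H (fun i b => forall c, R c b i)).
apply (definable2_Sigma2 (R := fun c i b => R c b i)); unfold D0_3; d0.
Qed.

(** The first witness [z] of the Sigma2 formula is sought together with [b]; a bound for the pairs
    also bounds their components. *)
Lemma Pi1_bounding_BSigma2 : Pi1_bounding -> BSigma 2 N.
Proof.
intros H P (phi & rho & sigma & H1 & H2 & H3) n Hn.
destruct (holds_Sigma2 H1 H2) as (Q & HQ & HQe).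
destruct (H (fun c d i => exists z b, d = ⟨z, b⟩ /\ Q c z (scons i (scons b rho))))
  with (n := n) as (B & HB).
- unfold D0_3; d0.
  apply (@D0_env (fun rho => Q (rho 0) (rho 1) (fun i => rho (S (S i))))
    (fun i => match i with
      | 0 => inl 2 | 1 => inl 1 | 2 => inl 4 | 3 => inl 0 | S (S (S (S i))) => inr (rho i) end)
    (fun r => scons (r 2) (scons (r 1) (scons (r 4) (scons (r 0) rho))))); auto.
  intros r [|[|[|[|i]]]]; reflexivity.
- intros i Hi; destruct (Hn i Hi) as (b & Hb).
  apply H3, HQe in Hb as (z & Hz); exists ⟨z, b⟩; intros c; exists z, b; auto.
- exists B; intros i Hi; destruct (HB i Hi) as (d & Hd & K).
  destruct (K zero) as (z & b & -> & _); exists b; split.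
  + exact (le_lt_trans (pair_le_r _ _) Hd).
  + apply H3, HQe; exists z; intros c.
    destruct (K c) as (z' & b' & E & K'); now apply pair_inj in E as [<- <-].
Qed.

(** That [b] bounds the [i]th set is a Pi1 statement: a single [c] bounds the element [x], the index
    [e], the witness [z] that [e] is the value of [f] at [i], and the computation [t]. *)
Lemma Pi1_bounding_finite_union : Pi1_bounding -> finite_union_principle N.
Proof.
intros H A HA f [Hf _] n Hn.
destruct (definable2_Sigma1_inv Hf) as (F & HF3 & HFe).
destruct (H (fun c b i => forall x, x < c -> forall e, e < c -> forall z, z < c ->
    forall t, t < c -> forall y, y < t ->
    (F z i e /\ computation A t /\ inset ⟨e, ⟨x, y⟩⟩ t) -> x < b))
  with (n := n) as (B & HB).
- unfold D0_3; d0.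
- intros i Hi; destruct (Hn i Hi) as (b & Hb); exists b.
  intros _ x _ e _ z _ t _ y _ (K1 & K2 & K3); apply Hb.
  assert (E : f i = e) by (apply HFe; eauto); rewrite E.
  apply W_Comp; exists y, t; auto.
- exists B; intros x (i & Hi & Hx); destruct (HB i Hi) as (b & Hb & K).
  apply W_Comp in Hx as (y & t & Ct & It).
  destruct (proj1 (HFe i (f i)) eq_refl) as (z & Hz).
  refine (lt_trans _ Hb).
  apply (K (x + f i + z + t + one)) with (f i) z t y; auto.
  + apply lt_ex; exists (f i + z + t); ring.
  + apply lt_ex; exists (x + z + t); ring.
  + apply lt_ex; exists (x + f i + t); ring.
  + apply lt_ex; exists (x + f i + z); ring.
  + refine (le_lt_trans _ (inset_bound It)).
    exact (le_trans (pair_le_r _ _) (pair_le_r _ _)).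
Qed.

(* The c.e. sets are the initial segments of the numbers x such that every
   b <= x has been refuted. *)
Lemma finite_union_Pi1_bounding : finite_union_principle N -> Pi1_bounding.
Proof.
intros H R HR n Hn.
destruct (@Sigma1_uniformly_ce (fun z x i => forall b, b < x + one ->
    exists c, c < z /\ ~ R c b i)) as (A & g & HA & Hg & HW).
{ unfold D0_3; d0. }
destruct (H A HA g Hg n) as (B & HB).
- intros i Hi; destruct (Hn i Hi) as (b & Hb); exists b; intros x Hx.
  apply HW in Hx as (z & Hz); apply NNPP; intros L.
  destruct (Hz b (not_lt_le L)) as (c & _ & Hc); auto.
- exists (B + one); intros i Hi; apply NNPP; intros K.
  (* If every [b] up to [B] were refuted, Sigma1 bounding would collect the refutations below one
     stage and put [B] itself into the union, which lies below [B]. *)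
  apply (@lt_irrefl B), HB; exists i; split; auto.
  apply HW, (@Sigma1_bounding (fun c b => ~ R c b i)); [unfold D0_2; d0|].
  intros b Hb; apply NNPP; intros L; apply K; exists b; split; auto.
  intros c; apply NNPP; eauto.
Qed.

Lemma Pi1_bounding_PHP : Pi1_bounding -> infinite_PHP (Sigma 1) N.
Proof.
intros H k C _ Hk HC X HX Hinf Hdom.
destruct (definable2_Sigma1_inv HC) as (Q & HQ & HQe).
apply NNPP; intros Hn; apply Hinf.
destruct (H (fun c b x => forall y, y < c -> forall z, z < c ->
    (Q z y x /\ X y) -> y < b)) with (n := k) as (B & HB).
- unfold D0_3; d0.
- intros x Hx; apply NNPP; intros K; apply Hn; exists x; split; auto.
  intros (b & Hb); apply K; exists b; intros _ y _ z _ [Hz Xy].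
  apply Hb; split; auto; apply HQe; eauto.
- exists B; intros y Xy; destruct (Hdom y Xy) as (x & Hx).
  destruct (HB x (Hk _ _ Hx)) as (b & Hb & K).
  apply HQe in Hx as (z & Hz); refine (lt_trans _ Hb).
  apply (K (y + z + one)) with z; auto; apply lt_ex; [exists z | exists y]; ring.
Qed.

(* Colour s by the first i < n whose current guess, the least b <= s not
   refuted by any c <= s, is largest.  If colour i occurs infinitely often, a
   true witness for i bounds the guesses of all j < n forever. *)
Lemma PHP_Pi1_bounding : infinite_PHP (Sigma 1) N -> Pi1_bounding.
Proof.
intros H R HR n Hn.
destruct (classic (n = zero)) as [-> | Hn0].
{ exists zero; intros i Hi; now apply not_lt0 in Hi. }
pose (good b i s := forall c, c < s + one -> R c b i).
(* Compares the guesses without naming them. An index all of whose candidates up to [s] are refuted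
   counts as largest, since the condition on [j] is then vacuous. *)
pose (Le s i j := forall b, b < s + one -> good b j s ->
  exists b', b' < b + one /\ good b' i s).
pose (top s i := forall j, j < n -> Le s j i).
destruct (@Delta0_set (fun _ => True)) as (X & HX & HXe).
{ apply D0_ext with (fun rho => rho 0 = rho 0); [tauto | d0]. }
destruct (H n (fun s i => i < n /\ (top s i /\ forall i', i' < i -> ~ top s i'))) with (X := X)
  as (i & Hi & Hinf); auto.
- intros s i i' (_ & T1 & M1) (_ & T2 & M2).
  destruct (lt_total i i') as [L | [L | L]]; auto.
  + now apply M2 in L.
  + now apply M1 in L.
- intros s i K; apply K.
- apply definable2_Delta0; [exact Delta0_Sigma1|].
  unfold D0_2, top, Le, good; d0.
- intros (b & Hb); apply (@lt_irrefl b), Hb; now apply HXe.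
- intros s _; destruct (@preorder_max (Le s) n) as (j & Hj & Hmax); auto.
  + unfold D0_2, Le, good; d0.
  + intros i j Hi Hj; apply NNPP; intros K; apply not_or_and in K as [K1 K2].
    apply K2; intros b Hb Gb; apply NNPP; intros K3.
    apply K1; intros b' Hb' Gb'.
    destruct (classic (b < b' + one)) as [L | L]; [eauto|].
    exfalso; apply K3; exists b'; split; auto.
    apply not_lt_le in L; apply (lt_trans (lt_succ b')); exact L.
  + intros i j k Hi Hj Hk L1 L2 b Hb Gb; destruct (L2 b Hb Gb) as (b' & Hb' & Gb').
    destruct (L1 b' (le_trans Hb' Hb) Gb') as (b2 & Hb2 & Gb2).
    exists b2; split; auto; exact (le_trans Hb2 Hb').
  + destruct (@D0_least (fun i => i < n /\ top s i)) with (x := j) as (i & [Hi Ti] & Hm); auto.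
    { unfold D0_1, top, Le, good; d0. }
    exists i; repeat split; auto; intros i' Hi' T; apply (Hm i' Hi').
    split; auto; exact (lt_trans Hi' Hi).
- destruct (Hn i Hi) as (b & Hb); exists (b + one); intros j Hj.
  apply NNPP; intros K.
  destruct (@Sigma1_bounding (fun c b => ~ R c b j) (b + one)) as (z & Hz).
  { unfold D0_2; d0. }
  { intros b' Hb'; apply NNPP; intros L; apply K; exists b'; split; auto.
    intros c; apply NNPP; eauto. }
  (* From stage [z + b] on, both [b] and the refutations, found below [z], of all candidates up to
     [b] for [j] are visible. Colour [i] at such a stage would give [j] an unrefuted guess at most
     [b]. *)
  apply Hinf; exists (z + b); intros s [(_ & T & _) _]; apply NNPP; intros L.
  apply not_lt_le in L.
  destruct (T j Hj b) as (b' & Hb' & G).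
  + refine (le_trans _ L); apply le_ex; exists z; ring.
  + intros c _; apply Hb.
  + destruct (Hz b' Hb') as (c & Hc & Rc); apply Rc, G.
    apply (lt_le_trans Hc); apply lt_S; refine (le_lt_trans _ L).
    apply le_ex; exists b; ring.
Qed.

End WithSet.
End Model.

Theorem theorem3 (N : structure) (HF : modelF N) :
  (finite_union_principle N <-> BSigma 2 N) /\
  (BSigma 2 N <-> infinite_PHP (Sigma 1) N).
Proof.
split; split.
(* Each implication takes the set it needs for interpreting set variables from the data of its
   conclusion: a parameter of [P], the oracle [A] or the infinite set [X]. *)
- intros H P HP; pose proof HP as (_ & _ & sigma & _ & Hs & _).
  apply (Pi1_bounding_BSigma2 HF (Hs 0)); auto.
  exact (finite_union_Pi1_bounding HF (Hs 0) H).
- intros H A HA; apply (Pi1_bounding_finite_union HF HA); auto.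
  exact (BSigma2_Pi1_bounding HF HA H).
- intros H k C C1 C2 HC X HX; apply (Pi1_bounding_PHP HF HX); auto.
  exact (BSigma2_Pi1_bounding HF HX H).
- intros H P HP; pose proof HP as (_ & _ & sigma & _ & Hs & _).
  apply (Pi1_bounding_BSigma2 HF (Hs 0)); auto.
  exact (PHP_Pi1_bounding HF (Hs 0) H).
Qed.
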